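(* Let $S=R[x;\tau,\delta]$ be a Cauchon extension with respect to a torus $H$ such that $\tau$ acts diagonalizably on $R$. Let $W$ be a Coxeter group with fixed generating set, $a$ one of its generators, and $\overline w\in W$ an element with $\overline w<\overline wa$. Suppose there is an isomorphism of partially ordered sets $\nabla:W^{\leq\overline w}\to\operatorname{spec}_HR$ such that $\nabla(W_i)=\mathcal P_i$ for $i=1,2,3$. Then the map $\nabla'=\tilde C\circ\nabla:W^{\leq\overline w}\to\operatorname{spec}_HS$ extends to an isomorphism of partially ordered sets $\tilde\nabla:W^{\leq\overline wa}\to\operatorname{spec}_HS$.
   Context: **Coxeter side.** $W$ is a Coxeter group $\langle s_1,\dots,s_n:(s_is_j)^{m_{ij}}=1\rangle$ considered with respect to this fixed generating set (''generator'' means one of the $s_i$); $\leq$ is the Bruhat order, and $W^{\leq v}=[1,v]=\{w\in W:w\leq v\}$ with the induced order. For $\overline w<\overline wa$ set $W_1=\{w\in W^{\leq\overline wa}:wa\leq w\leq\overline w\}$, $W_2=\{w\in W^{\leq\overline wa}:w\leq wa\leq\overline w\}$, $W_3=\{w\in W^{\leq\overline wa}:wa\not\leq\overline w\}$; one has $W_1\cup W_2\cup W_3=W^{\leq\overline w}$. **Cauchon extensions.** $k$ is a field. Let $R$ be a noetherian $k$-algebra and $S=R[x;\tau,\delta]$ an Ore extension ($\tau$ an algebra automorphism of $R$, $\delta$ a $k$-linear $\tau$-derivation, $xr=\tau(r)x+\delta(r)$ for $r\in R$). $S$ is a Cauchon extension of $R$ (with respect to $H$) if: (i) $\delta$ is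 locally nilpotent; (ii) $\delta\tau=q\tau\delta$ with $q\in k^\times$ not a root of unity; (iii) $H$ is an abelian group acting on $S$ by algebra automorphisms; (iv) $R$ is $H$-stable and $x$ is an $H$-eigenvector; (v) there is $h_0\in H$ such that $h_0|_R=\tau$ and the $h_0$-eigenvalue of $x$ is not a root of unity; (vi) every $H$-prime ideal of $R$ is completely prime. (An $H$-prime ideal is a proper $H$-stable ideal $P$ such that $IJ\subseteq P$ with $I,J$ $H$-stable ideals implies $I\subseteq P$ or $J\subseteq P$.) Here $H$ is moreover a torus. ''$\tau$ acts diagonalizably on $R$'' means $R$ is spanned by $\tau$-eigenvectors. $\operatorname{spec}_HA$ denotes the set of $H$-stable (torus-invariant) prime ideals of $A$, ordered by inclusion. **Subsets of the spectrum of $R$.** $\mathcal P_3=\{P\in\operatorname{spec}_HR:\delta(R)\subseteq P\}$, $\mathcal P_2=\{P\in\operatorname{spec}_HR:\delta(P)\subseteq P\}\setminus\mathcal P_3$, $\mathcal P_1=\operatorname{spec}_HR\setminus(\mathcal P_2\cup\mathcal P_3)$. **The map $\tilde C$.** Let $L=S[x^{-1}]$. Cauchon's deleting-derivation homomorphism is $C:R\to L$, $C(r)=\sum_{l\geq0}q_l\,\delta^l\tau^{-l}(r)x^{-l}$ with $q_l=q^{l(l+1)/2}(q-1)^{-l}/(l)!_q$, $(l)!_q=\prod_{i=1}^l\frac{q^i-1}{q-1}$. Define $\tilde C:\operatorname{spec}_HR\to\{Q\in\operatorname{spec}_HS:x\notin Q\}$ by $\tilde C(P)=\langle C(P)\rangle_L\cap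 S$, where $\langle\cdot\rangle_L$ is the two-sided ideal of $L$ generated. *)

(* Defs.v *)
From HB Require Import structures.
From Stdlib Require Import Relation_Operators.
From mathcomp Require Import all_boot all_order all_algebra.
From mathcomp Require Import boolp classical_sets functions cardinality fsbigop.

Set Implicit Arguments.
Unset Strict Implicit.
Unset Printing Implicit Defensive.

Import GRing.Theory.

Local Open Scope classical_set_scope.
Local Open Scope ring_scope.

Definition poset_iso (T U : Type) (leT : T -> T -> Prop) (leU : U -> U -> Prop)
    (A : set T) (B : set U) (f : T -> U) : Prop :=
  set_bij A B f /\
  forall x y : T, A x -> A y -> (leT x y <-> leU (f x) (f y)).

Section Coxeter.
Local Open Scope group_scope.

(* m i j = 0 encodes m_ij = oo: the relation (s_i s_j)^0 = 1 is then void. *)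
Record coxeter_matrix (n : nat) (m : 'I_n -> 'I_n -> nat) : Prop := {
  coxm_diag : forall i, m i i = 1%N;
  coxm_sym : forall i j, m i j = m j i;
  coxm_off : forall i j, i != j -> m i j != 1%N }.

(* W is presented by the generators s_i and the relations (s_i s_j)^(m_ij) = 1.
   Words in the s_i suffice for generation, since (s_i)^2 = 1. *)
Record coxeter_group (n : nat) (m : 'I_n -> 'I_n -> nat)
    (W : groupType) (s : 'I_n -> W) : Prop := {
  cox_matrix : coxeter_matrix m;
  cox_rel : forall i j, (s i * s j) ^+ m i j = 1;
  cox_gen : forall w : W, exists l : seq 'I_n, w = \prod_(i <- l) s i;
  cox_univ : forall (G : groupType) (t : 'I_n -> G),
    (forall i j, (t i * t j) ^+ m i j = 1) ->
    exists f : {multiplicative W -> G}, forall i, f (s i) = t i }.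

Context (n : nat) (W : groupType) (s : 'I_n -> W).

Definition expressible (w : W) (k : nat) : Prop :=
  exists2 l : seq 'I_n, size l = k & w = \prod_(i <- l) s i.

Definition cox_length (w : W) : nat :=
  xget 0%N [set k | expressible w k /\ forall k', expressible w k' -> (k <= k')%N].

Definition cox_reflection (t : W) : Prop := exists i g, t = s i ^ g.

Definition bruhat_step (u v : W) : Prop :=
  (exists2 t, cox_reflection t & v = u * t) /\ (cox_length u < cox_length v)%N.

Definition bruhat : W -> W -> Prop := clos_refl_trans W bruhat_step.

Definition bruhat_lt (u v : W) : Prop := bruhat u v /\ u <> v.

Definition bruhat_below (v : W) : set W := [set w | bruhat w v].

Definition W1 (wb a : W) : set W :=
  [set w | [/\ bruhat_below (wb * a) w, bruhat (w * a) w & bruhat w wb]].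

Definition W2 (wb a : W) : set W :=
  [set w | [/\ bruhat_below (wb * a) w, bruhat w (w * a) & bruhat (w * a) wb]].

Definition W3 (wb a : W) : set W :=
  [set w | bruhat_below (wb * a) w /\ ~ bruhat (w * a) wb].

End Coxeter.

Section Ideals.
Context (A : nzRingType).

Definition left_ideal (I : set A) : Prop :=
  [/\ I 0, forall a b, I a -> I b -> I (a + b) & forall r a, I a -> I (r * a)].

Definition right_ideal (I : set A) : Prop :=
  [/\ I 0, forall a b, I a -> I b -> I (a + b) & forall r a, I a -> I (a * r)].

Definition two_sided_ideal (I : set A) : Prop := left_ideal I /\ right_ideal I.

Definition acc (ideal : set A -> Prop) : Prop :=
  forall I : nat -> set A, (forall i, ideal (I i)) ->
    (forall i, I i `<=` I i.+1) ->
    exists N, forall i, (N <= i)%N -> I i = I N.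

Definition noetherian : Prop := acc left_ideal /\ acc right_ideal.

Definition proper_ideal (P : set A) : Prop := two_sided_ideal P /\ P <> setT.

(* For an ideal P, IJ `<=` P amounts to containing the products ab. *)
Definition prime_ideal (P : set A) : Prop :=
  proper_ideal P /\
  forall I J, two_sided_ideal I -> two_sided_ideal J ->
    (forall a b, I a -> J b -> P (a * b)) -> I `<=` P \/ J `<=` P.

Definition completely_prime (P : set A) : Prop :=
  proper_ideal P /\ forall a b, P (a * b) -> P a \/ P b.

Definition ideal_generated (X : set A) : set A := smallest two_sided_ideal X.

End Ideals.

Section GroupAction.
Context (k : fieldType) (H : groupType).

(* A torus is a group isomorphic to (k^x)^r. *)
Definition torus : Prop :=
  exists r (phi : H -> 'rV[k]_r),
    set_bij [set: H] [set v : 'rV[k]_r | forall i, v 0 i != 0] phi /\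
    forall g h i, phi (g * h)%g 0 i = phi g 0 i * phi h 0 i.

Context (A : algType k) (act : H -> {lrmorphism A -> A}).

Definition algebra_action : Prop :=
  (forall a, act 1%g a = a) /\ (forall g h a, act (g * h)%g a = act g (act h a)).

Definition Hstable (X : set A) : Prop := forall h a, X a -> X (act h a).

Definition Hprime_ideal (P : set A) : Prop :=
  [/\ proper_ideal P, Hstable P &
   forall I J, two_sided_ideal I -> Hstable I -> two_sided_ideal J -> Hstable J ->
    (forall a b, I a -> J b -> P (a * b)) -> I `<=` P \/ J `<=` P].

Definition specH : set (set A) := [set P | prime_ideal P /\ Hstable P].

End GroupAction.

Definition not_root_of_unity (k : fieldType) (c : k) : Prop :=
  forall i, (0 < i)%N -> c ^+ i != 1.

(* iota embeds R in S and tauV is the inverse of tau; ore_basis says that S is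
   a free left R-module on the powers of x. *)
Record ore_extension (k : fieldType) (R S : algType k)
    (iota : {lrmorphism R -> S}) (x : S)
    (tau : {lrmorphism R -> R}) (tauV : R -> R) (delta : {linear R -> R}) : Prop := {
  ore_tauK : cancel tau tauV;
  ore_tauVK : cancel tauV tau;
  ore_deriv : forall r r', delta (r * r') = tau r * delta r' + delta r * r';
  ore_comm : forall r, x * iota r = iota (tau r) * x + iota (delta r);
  ore_basis : bijective (fun p : {poly R} => \sum_(i < size p) iota p`_i * x ^+ i) }.

(* actR is the restriction to R of the action of H on S, so that cau_Rstable
   expresses that R is H-stable. *)
Record cauchon_extension (k : fieldType) (R S : algType k)
    (iota : {lrmorphism R -> S}) (x : S)
    (tau : {lrmorphism R -> R}) (tauV : R -> R) (delta : {linear R -> R}) (q : k)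
    (H : groupType) (act : H -> {lrmorphism S -> S})
    (actR : H -> {lrmorphism R -> R}) : Prop := {
  cau_noeth : noetherian R;
  cau_ore : ore_extension iota x tau tauV delta;
  cau_nilp : forall r, exists i, iter i delta r = 0;
  cau_q0 : q != 0;
  cau_q : not_root_of_unity q;
  cau_comm : forall r, delta (tau r) = q *: tau (delta r);
  cau_abelian : forall g h : H, (g * h = h * g)%g;
  cau_action : algebra_action act;
  cau_Rstable : forall h r, act h (iota r) = iota (actR h r);
  cau_eigen : forall h, exists c : k, act h x = c *: x;
  cau_h0 : exists h0, (forall r, actR h0 r = tau r) /\
    exists2 c : k, act h0 x = c *: x & not_root_of_unity c;
  cau_cprime : forall P : set R, Hprime_ideal actR P -> completely_prime P }.

Definition acts_diagonalizably (k : fieldType) (R : algType k)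
    (tau : {lrmorphism R -> R}) : Prop :=
  forall r, exists d (v : 'I_d -> R) (c : 'I_d -> k),
    (forall i, tau (v i) = c i *: v i) /\ r = \sum_(i < d) v i.

Section SpecSubsets.
Context (k : fieldType) (R : algType k) (delta : {linear R -> R}).
Context (H : groupType) (actR : H -> {lrmorphism R -> R}).

Definition P3 : set (set R) :=
  [set P | specH actR P /\ range delta `<=` P].

Definition P2 : set (set R) :=
  [set P | specH actR P /\ delta @` P `<=` P] `\` P3.

Definition P1 : set (set R) := specH actR `\` (P2 `|` P3).

End SpecSubsets.

(* j exhibits L as the right Ore localization of S at the powers of x. *)
Record localization_at_powers (k : fieldType) (S : algType k) (x : S)
    (L : unitAlgType k) (j : {lrmorphism S -> L}) : Prop := {
  loc_unit : j x \is a GRing.unit;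
  loc_frac : forall y, exists s i, y = j s * j x ^- i;
  loc_ker : forall s, j s = 0 <-> exists i, s * x ^+ i = 0 }.

Section DeletingDerivation.
Context (k : fieldType) (R S : algType k) (iota : {lrmorphism R -> S}) (x : S).
Context (tauV : R -> R) (delta : {linear R -> R}) (q : k).
Context (L : unitAlgType k) (j : {lrmorphism S -> L}).

Definition qfact (l : nat) : k := \prod_(1 <= i < l.+1) ((q ^+ i - 1) / (q - 1)).

Definition qcoef (l : nat) : k :=
  q ^+ (l * l.+1)./2 * (q - 1) ^- l / qfact l.

(* The sum has finite support because delta is locally nilpotent and
   delta^l tau^-l is a scalar multiple of tau^-l delta^l. *)
Definition cauchonC (r : R) : L :=
  \sum_(l \in [set: nat])
    qcoef l *: (j (iota (iter l delta (iter l tauV r))) * j x ^- l).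

Definition Ctilde (P : set R) : set S :=
  j @^-1` ideal_generated (cauchonC @` P).

End DeletingDerivation.

(* Main.v *)
(* The H-primes of S not containing x are the Ctilde P for P in spec_H R: with C
   multiplicative and x C(r) = C(tau r) x, the ring L is a skew Laurent extension
   of C(R), and since tau is diagonalizable and the h0-eigenvalue of x is not a
   root of unity, an H-stable ideal of L splits into its components along the
   powers of x. The H-primes containing x are the P' + S x with delta(R) in P'.

   The two parts are compared as follows: Ctilde P is contained in P' + S x iff
   its contraction to R, the largest delta-stable H-prime contained in P, is
   contained in P'. On the Coxeter side, the elements below wb a but not below wb
   are the u a with u in W_3, and v <= u a iff min(v, v a) <= u, where min(v, v a)
   is the largest element of the union of W_2 and W_3 below v. Since nabla matches
   W_2 and W_3 with P_2 and P_3, the two descriptions agree when nabla is extended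
   by u a |-> nabla(u) + S x. *)

(* The obstacle is an [H]-prime [Q] of [S] without [x]. Primes of [S] are not assumed completely
   prime and [x] need not be normal, so [x] could be a zero divisor modulo [Q], and [Q] would not be
   recovered from [L]. A chain condition and primeness leave the alternative that [Q] contains a
   power of [x]. Then [delta] is nilpotent modulo the contraction of [Q] to [R]; this contraction is
   completely prime, so the q-Leibniz rule, with [q] not a root of unity, forces [delta] to vanish
   modulo it. Now [x] is normal modulo [Q], and primeness puts [x] into [Q]. That [C] is
   multiplicative is not read off from q-binomial identities: for a [tau]-eigenvector [r] and large
   [n], [C r x^n] lies in [S], where its leading term, its [h0]-weight and its commutation with [x]
   determine it. The lifting property of the Bruhat order rests on the strong exchange condition,
   obtained from the universal property of [W] applied to a cocycle. *)
Require Import Defs.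
From HB Require Import structures.
From Stdlib Require Import Relation_Operators Operators_Properties.
From mathcomp Require Import all_boot all_algebra.
From mathcomp Require Import boolp classical_sets functions fsbigop.
From mathcomp Require Import ring.

Set Implicit Arguments.
Unset Strict Implicit.
Unset Printing Implicit Defensive.

Import GRing.Theory.

(** * The Bruhat order *)

Section CocyclePair.
Local Open Scope group_scope.

(* The semidirect product of the group of subsets of W (under symmetric
   difference) by W acting by conjugation; the homomorphism from a Coxeter
   group sending s_i to ({s_i}, s_i) records the right inversion sets. *)
Record cocycle_pair (W : Type) := CocyclePair { cp_set : W -> bool; cp_elt : W }.

HB.instance Definition _ (W : Type) := gen_eqMixin (cocycle_pair W).
HB.instance Definition _ (W : Type) := gen_choiceMixin (cocycle_pair W).

Context (W : groupType).
Implicit Types a b c : cocycle_pair W.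

Definition cp_mul a b : cocycle_pair W :=
  CocyclePair
    (fun t => cp_set a (cp_elt b * t * (cp_elt b)^-1) (+) cp_set b t)
    (cp_elt a * cp_elt b).
Definition cp_one : cocycle_pair W := CocyclePair (fun=> false) 1.
Definition cp_inv a : cocycle_pair W :=
  CocyclePair (fun t => cp_set a ((cp_elt a)^-1 * t * cp_elt a)) (cp_elt a)^-1.

Lemma cp_mulA : associative cp_mul.
Proof.
move=> a b c; congr CocyclePair; last by rewrite /= mulgA.
by apply/funext => t /=; rewrite addbA invgM !mulgA.
Qed.

Lemma cp_mul1 : left_id cp_one cp_mul.
Proof. by case=> u v; congr CocyclePair; rewrite /= ?mul1g. Qed.

Lemma cp_mulg1 : right_id cp_one cp_mul.
Proof.
case=> u v; congr CocyclePair; rewrite /= ?mulg1 //.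
by apply/funext => t /=; rewrite addbF invg1 mulg1 mul1g.
Qed.

Lemma cp_mulV : left_inverse cp_one cp_inv cp_mul.
Proof.
case=> u v; congr CocyclePair; rewrite /= ?mulVg //.
by apply/funext => t /=; rewrite !mulgA mulVg mul1g mulgVK addbb.
Qed.

Lemma cp_mulgV : right_inverse cp_one cp_inv cp_mul.
Proof.
case=> u v; congr CocyclePair; rewrite /= ?mulgV //.
by apply/funext => t /=; rewrite invgK addbb.
Qed.

HB.instance Definition _ := isGroup.Build (cocycle_pair W)
  cp_mulA cp_mul1 cp_mulg1 cp_mulV cp_mulgV.

Definition cp_gen (v : W) : cocycle_pair W := CocyclePair (fun t => t == v) v.

(** Each factor [u v] adds two reflections of the dihedral group of [u] and [v], and all of them
    have the form [v (u v)^i]. *)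
Lemma cp_genM_exp (u v : W) (d : nat) : u * u = 1 -> v * v = 1 ->
  (cp_gen u * cp_gen v) ^+ d =
  CocyclePair (fun t => \big[addb/false]_(i < d.*2) (t == v * (u * v) ^+ i))
    ((u * v) ^+ d).
Proof.
move=> uu vv; have uV : u^-1 = u by apply: mulg1_eq.
have vV : v^-1 = v by apply: mulg1_eq.
have swap e : (u * v) ^- e * v = v * (u * v) ^+ e.
  elim: e => [|e IHe]; first by rewrite expg0 invg1 mulg1 mul1g.
  by rewrite {1}expgSr invgM -mulgA IHe expgS invgM uV vV !mulgA.
have conj e (t w : W) : ((u * v) ^+ e * t / (u * v) ^+ e == w) =
    (t == (u * v) ^- e * w * (u * v) ^+ e).
  by rewrite divg_eq -(inj_eq (mulgI ((u * v) ^- e))) mulKg !mulgA.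
elim: d => [|d IHd].
  by rewrite !expg0; congr CocyclePair; apply/funext => t; rewrite big_ord0.
rewrite expgS IHd.
have -> : (u * v) ^+ d.+1 = (u * v) * (u * v) ^+ d by rewrite expgS.
congr CocyclePair; apply/funext => t /=.
rewrite doubleS !big_ord_recr /= addbC -addbA; congr (_ (+) _).
rewrite (conj d t v) swap -[v * _ * (_ ^+ _)]mulgA -expgnDr addnn addbC; congr (_ (+) _).
rewrite divg_eq -(inj_eq (mulgI v)) mulgA vv mul1g conj; congr (_ == _).
by rewrite [_ * (v * _)]mulgA swap -[v * _ * (u * v)]mulgA -expgSr -mulgA -expgnDr addSn addnn.
Qed.

End CocyclePair.

Section Bruhat.
Local Open Scope group_scope.
Context (n : nat) (m : 'I_n -> 'I_n -> nat) (W : groupType) (s : 'I_n -> W).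
Hypothesis hW : coxeter_group m s.

Lemma gen_sq i : s i * s i = 1.
Proof. by have := cox_rel hW i i; rewrite (coxm_diag (cox_matrix hW)). Qed.

Lemma genV i : (s i)^-1 = s i.
Proof. by apply: mulg1_eq; apply: gen_sq. Qed.

Lemma gen_mulK i w : w * s i * s i = w.
Proof. by rewrite -mulgA gen_sq mulg1. Qed.

Lemma cox_length_spec w : expressible s w (cox_length s w) /\
  forall k, expressible s w k -> (cox_length s w <= k)%N.
Proof.
have [l wl] := cox_gen hW w.
have /ex_minnP[k /asboolP wk mink] : exists k, `[< expressible s w k >].
  by exists (size l); apply/asboolP; exists l.
rewrite /cox_length; case: xgetP => [k' _ //|/(_ k)[]].
by split=> // k' wk'; apply: mink; apply/asboolP.
Qed.

(* For a reflection t, N w t means l(w t) < l(w). *)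
Lemma inversion_cocycle : exists N : W -> W -> bool,
  (forall v w t, N (v * w) t = N v (w * t * w^-1) (+) N w t) /\
  (forall i t, N (s i) t = (t == s i)).
Proof.
have [|f fs] := cox_univ hW (t := fun i => cp_gen (s i)).
  move=> i j; rewrite cp_genM_exp ?gen_sq// (cox_rel hW i j).
  congr CocyclePair; apply/funext => t.
  (* The list of reflections has [2 m_ij] entries and period [m_ij], so its two halves cancel. *)
  rewrite -addnn big_split_ord /= -[RHS](addbb (\big[addb/false]_(l < m i j)
    (t == s j * (s i * s j) ^+ l))); congr (_ (+) _).
  by apply: eq_bigr => l _; rewrite expgnDr (cox_rel hW i j) mul1g.
have fE w : cp_elt (f w) = w.
  have [l ->] := cox_gen hW w; elim: l => [|i l IHl].
    (* Only multiplicativity of [f] is given; the second component of [f 1] is 1 because it is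
       idempotent. *)
    have /mulgI f1 : cp_elt (f 1) * cp_elt (f 1) = cp_elt (f 1) * 1.
      by rewrite mulg1 -[in RHS](mul1g 1) gmulfM.
    by rewrite big_nil f1.
  by rewrite big_cons gmulfM /= IHl fs.
exists (fun w => cp_set (f w)); split=> [v w t|i t]; last by rewrite fs.
by rewrite gmulfM /= fE.
Qed.

Section Inversions.
Context (N : W -> W -> bool).
Hypothesis NM : forall v w t, N (v * w) t = N v (w * t * w^-1) (+) N w t.
Hypothesis Ns : forall i t, N (s i) t = (t == s i).

Lemma inversion1 t : N 1 t = false.
Proof. by have := NM 1 1 t; rewrite invg1 !mulg1 mul1g; case: (N 1 t). Qed.

(** The strong exchange condition. By the cocycle rule, [N] counts modulo 2 the letters whose
    conjugate by the rest of the word is [t]; if the count is odd there is such a letter, and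
    multiplying by [t] deletes it. *)
Lemma inversion_word l t : N (\prod_(i <- l) s i) t ->
  exists2 l', (size l' < size l)%N & (\prod_(i <- l) s i) * t = \prod_(i <- l') s i.
Proof.
elim: l => [|i l IHl]; first by rewrite big_nil inversion1.
rewrite big_cons NM; case Nt: (N (\prod_(j <- l) s j) t); first move=> _.
  have [l' ltl El] := IHl Nt; exists (i :: l'); rewrite ?ltnS//.
  by rewrite big_cons -mulgA El.
rewrite addbF Ns => /eqP El; exists l; rewrite ?ltnS//.
by rewrite -[LHS]mulgA -[X in s i * X](mulgVK (\prod_(i <- l) s i)) El mulgA gen_sq mul1g.
Qed.

Lemma inversion_lt w t : N w t -> (cox_length s (w * t)%g < cox_length s w)%N.
Proof.
have [[l sl wl] _] := cox_length_spec w; rewrite {1}wl => /inversion_word[l' ltl El].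
have [_ minl] := cox_length_spec (w * t).
by rewrite -sl; apply: leq_ltn_trans ltl; apply: minl; exists l'; rewrite // wl.
Qed.

(** Expanding [t = g^-1 (s i) g] by the cocycle rule, the contributions of [g] and [g^-1] cancel as
    they do in [g^-1 g = 1], and [N (s i) (s i)] remains. *)
Lemma inversion_refl t : cox_reflection s t -> N t t.
Proof.
case=> i [g ->]; have := inversion1 (s i ^ g).
have gsg : g * (s i ^ g) * g^-1 = s i by rewrite conjgE !mulgA mulgV mul1g mulgK.
rewrite -[X in N X _](mulVg g) NM gsg => /esym.
rewrite {2}conjgE mulgA NM gsg NM Ns eqxx genV gen_mulK.
by case: (N _ _); case: (N _ _).
Qed.

Lemma refl_sq t : cox_reflection s t -> t * t = 1.
Proof. by case=> i [g ->]; rewrite -conjMg gen_sq conj1g. Qed.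

Lemma refl_gen i : cox_reflection s (s i).
Proof. by exists i, 1; rewrite conjg1. Qed.

Lemma inversion_mul_refl w t : cox_reflection s t -> N (w * t) t = ~~ N w t.
Proof. by move=> rt; rewrite NM mulgK (inversion_refl rt) addbT. Qed.

Lemma inversion_gt w t : cox_reflection s t -> ~~ N w t ->
  (cox_length s w < cox_length s (w * t)%g)%N.
Proof.
move=> rt; rewrite -inversion_mul_refl// => /inversion_lt.
by rewrite -mulgA refl_sq// mulg1.
Qed.

Lemma bruhat_step_inv u v : bruhat_step s u v <->
  exists t, [/\ cox_reflection s t, v = u * t & ~~ N u t].
Proof.
split=> [[[t rt ->] lt_uv]|[t [rt -> Nut]]].
  exists t; split=> //; apply/negP => /inversion_lt.
  by move/(ltn_trans lt_uv); rewrite ltnn.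
by split; [exists t|apply: inversion_gt].
Qed.

(* For a reflection t <> a, t is an inversion of u iff ata is one of ua. *)
Lemma step_lift i u v : bruhat_step s u v ->
  v = u * s i \/ bruhat_step s (u * s i) (v * s i).
Proof.
case/bruhat_step_inv => t [rt -> Nut].
have [->|neq_t] := eqVneq t (s i); first by left.
right; apply/bruhat_step_inv; exists (t ^ s i); split.
- by case: rt => i' [g ->]; exists i', (g * s i); rewrite conjgM.
- by rewrite conjgE -!mulgA mulVKg.
rewrite NM Ns conjgE mulVKg mulgK (negPf Nut) /=.
by rewrite -(inj_eq (mulgI (s i))) mulVKg (inj_eq (mulIg _)).
Qed.

End Inversions.

Lemma bruhat_trans v u w : bruhat s u v -> bruhat s v w -> bruhat s u w.
Proof. exact: rt_trans. Qed.

Lemma bruhat_length u v : bruhat s u v -> u = v \/ (cox_length s u < cox_length s v)%N.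
Proof.
elim=> [x y [_ lt_xy]|x|x y z _ [->|xy] _ [<-|yz]]; [by right|by left|by left| | |].
- by right.
- by right.
- by right; apply: ltn_trans yz.
Qed.

Lemma bruhat_anti u v : bruhat s u v -> bruhat s v u -> u = v.
Proof.
case/bruhat_length => // uv /bruhat_length[//|vu].
by have := ltn_trans uv vu; rewrite ltnn.
Qed.

Lemma bruhat_total_gen i u : bruhat s u (u * s i) \/ bruhat s (u * s i) u.
Proof.
have [N [NM Ns]] := inversion_cocycle.
case Nu: (N u (s i)); [right|left]; apply: rt_step; split.
- by exists (s i); [apply: refl_gen|rewrite gen_mulK].
- exact: (inversion_lt NM Ns).
- by exists (s i) => //; apply: refl_gen.
- by apply: (inversion_gt NM Ns); [apply: refl_gen|rewrite Nu].
Qed.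

(** The lifting property without any assumption on descents. A chain from [u] to [v], multiplied by
    [s i], is again a chain unless one of its steps is multiplication by [s i]; such a step joins
    the two chains, which gives the second alternative. *)
Lemma bruhat_lift i u v : bruhat s u v ->
  bruhat s (u * s i) (v * s i) \/ (bruhat s (u * s i) v /\ bruhat s u (v * s i)).
Proof.
have [N [NM Ns]] := inversion_cocycle.
move=> uv; elim: (clos_rt_rt1n _ _ _ _ uv) => {u v uv} [w|w v' y step v'y1 IH].
  by left; apply: rt_refl.
have v'y := clos_rt1n_rt _ _ _ _ v'y1.
case: (step_lift NM Ns i step) => [Ev|/(@rt_step _ _ _ _) step'].
- right; split; first by rewrite -Ev.
  case: IH => [|[_ v'yi]]; first by rewrite Ev gen_mulK.
  by apply: bruhat_trans v'yi; apply: rt_step.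
- case: IH => [v'i|[v'iy v'yi]]; first by left; apply: bruhat_trans v'i.
  right; split; first exact: bruhat_trans v'iy.
  by apply: bruhat_trans v'yi; apply: rt_step.
Qed.

Lemma bruhat_lift_up i u v : bruhat s u v -> bruhat s v (v * s i) ->
  bruhat s (u * s i) (v * s i).
Proof. by case/(bruhat_lift i) => // -[uiv _] vvi; apply: bruhat_trans vvi. Qed.

Lemma bruhat_lift_min i u v : bruhat s u v -> bruhat s u (u * s i) ->
  bruhat s u (v * s i).
Proof. by case/(bruhat_lift i) => [uivi uui|[]//]; apply: bruhat_trans uivi. Qed.

Lemma bruhat_lift_down i u v : bruhat s u v -> bruhat s (u * s i) u ->
  bruhat s (u * s i) (v * s i).
Proof. by case/(bruhat_lift i) => // -[_ uvi] uiu; apply: bruhat_trans uvi. Qed.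

(** * The sets W2 and W3 below [wb] *)

Context (i0 : 'I_n) (wb : W).
Hypothesis hwb : bruhat s wb (wb * s i0).

Lemma W3P u : W3 s wb (s i0) u <-> bruhat s u wb /\ ~ bruhat s (u * s i0) wb.
Proof.
split=> [[/(bruhat_lift i0) + nub]|[ub nub]].
  by rewrite gen_mulK => -[|[_]].
by split=> //; apply: bruhat_trans hwb.
Qed.

Lemma W2P u : W2 s wb (s i0) u <-> bruhat s u (u * s i0) /\ bruhat s (u * s i0) wb.
Proof.
split=> [[]//|[uui uib]]; split=> //.
by apply: bruhat_trans hwb; apply: bruhat_trans uib.
Qed.

Lemma bruhat_W3_gen u : W3 s wb (s i0) u -> bruhat s u (u * s i0).
Proof.
case/W3P => ub nub; case: (bruhat_total_gen i0 u) => // uiu.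
by case: nub; apply: bruhat_trans ub.
Qed.

Lemma below_gen_cases w : bruhat s w (wb * s i0) -> ~ bruhat s w wb ->
  W3 s wb (s i0) (w * s i0).
Proof.
move=> /(bruhat_lift i0); rewrite gen_mulK => -[wib|[]//] nwb.
by apply/W3P; rewrite gen_mulK.
Qed.

Lemma W3_below_gen u : W3 s wb (s i0) u -> bruhat s (u * s i0) (wb * s i0).
Proof. by case/W3P => ub _; apply: bruhat_lift_up. Qed.

Lemma W3_gen_mono u v : W3 s wb (s i0) u -> W3 s wb (s i0) v ->
  (bruhat s (u * s i0) (v * s i0) <-> bruhat s u v).
Proof.
move=> u3 v3; split=> uv; last exact: bruhat_lift_up (bruhat_W3_gen v3).
(* The other alternative puts [u a] below [v], hence below [wb], which [W3] forbids. *)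
case: (bruhat_lift i0 uv); rewrite !gen_mulK // => -[_ uiv].
case/W3P: u3 => _ []; case/W3P: v3 => vb _; exact: bruhat_trans vb.
Qed.

(* min (v, va) is the largest element below v of the union of W2 and W3. *)
Lemma below_max_W23 v : bruhat s v wb -> exists z,
  [/\ W2 s wb (s i0) z \/ W3 s wb (s i0) z, bruhat s z v,
    (forall z', W2 s wb (s i0) z' \/ W3 s wb (s i0) z' -> bruhat s z' v -> bruhat s z' z) &
    (forall u, W3 s wb (s i0) u -> (bruhat s v (u * s i0) <-> bruhat s z u))].
Proof.
move=> vb; case: (bruhat_total_gen i0 v) => vvi.
  exists v; split=> //; last 1 first.
  - move=> u u3; split=> vu; last exact: bruhat_trans (bruhat_W3_gen u3).
    by have := bruhat_lift_min vu vvi; rewrite gen_mulK.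
  - case: (EM (bruhat s (v * s i0) wb)) => vib; [left; exact/W2P|right; exact/W3P].
  - exact: rt_refl.
exists (v * s i0); split=> //.
- by left; apply/W2P; rewrite gen_mulK.
- move=> z' z23 z'v; apply: bruhat_lift_min => //.
  by case: z23 => [/W2P[]//|]; apply: bruhat_W3_gen.
- move=> u u3; split=> vu; last first.
    by have := bruhat_lift_up vu (bruhat_W3_gen u3); rewrite gen_mulK.
  by have := bruhat_lift_down vu vvi; rewrite gen_mulK.
Qed.

Lemma W23_below z : W2 s wb (s i0) z \/ W3 s wb (s i0) z -> bruhat s z wb.
Proof. by case=> [/W2P[zz]|/W3P[]//]; apply: bruhat_trans. Qed.

End Bruhat.

(** * Subspaces and eigenvectors *)

Local Open Scope classical_set_scope.
Local Open Scope ring_scope.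

Definition subspace (k : fieldType) (M : lmodType k) (V : set M) : Prop :=
  V 0 /\ forall (a : k) u v, V u -> V v -> V (a *: u + v).

Section Subspace.
Context (k : fieldType) (M : lmodType k) (V : set M).
Hypothesis hV : subspace V.

Lemma subspace0 : V 0. Proof. by case: hV. Qed.

Lemma subspaceZ a u : V u -> V (a *: u).
Proof. by move=> Vu; rewrite -[_ *: _]addr0; apply: (proj2 hV) => //; apply: subspace0. Qed.

Lemma subspaceD u v : V u -> V v -> V (u + v).
Proof. by move=> Vu Vv; rewrite -[u]scale1r; apply: (proj2 hV). Qed.

Lemma subspaceB u v : V u -> V v -> V (u - v).
Proof. by move=> Vu Vv; rewrite -scaleN1r addrC; apply: (proj2 hV). Qed.

Lemma subspaceZ_eq a u : a != 0 -> V (a *: u) <-> V u.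
Proof.
move=> a0; split=> [Vau|]; last exact: subspaceZ.
by rewrite -[u](scalerK a0); apply: subspaceZ.
Qed.

Lemma subspace_addl u v : V u -> V (u + v) <-> V v.
Proof.
move=> Vu; split=> [Vuv|Vv]; last exact: subspaceD.
by rewrite -[v](addKr u) addrC; apply: subspaceB.
Qed.

Lemma subspace_addr u v : V u -> V (v + u) <-> V v.
Proof. by rewrite addrC; apply: subspace_addl. Qed.

Lemma subspace_sum I (r : seq I) (P : pred I) F :
  (forall i, P i -> V (F i)) -> V (\sum_(i <- r | P i) F i).
Proof. by move=> VF; apply: big_ind => //; [apply: subspace0|apply: subspaceD]. Qed.

End Subspace.

Section Eigen.
Context (k : fieldType) (M : lmodType k) (T : M -> M).
Hypothesis linT : linear T.

Let T0 : T 0 = 0.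
Proof. by have := linT (-1) 0 0; rewrite scaler0 add0r scaleN1r addNr. Qed.

Let T_sum I (r : seq I) (F : I -> M) : T (\sum_(i <- r) F i) = \sum_(i <- r) T (F i).
Proof.
apply: (big_morph T (op1 := +%R)) => [u v|]; first by rewrite -[u]scale1r linT !scale1r.
exact: T0.
Qed.

(** Applying [T - w i0] kills one summand and scales each of the others by a nonzero difference of
    eigenvalues, which allows induction on the number of summands. *)
Lemma eigen_components (V : set M) (I : eqType) (r : seq I) (w : I -> k) (v : I -> M) :
  subspace V -> (forall u, V u -> V (T u)) ->
  uniq r -> {in r &, injective w} -> (forall i, i \in r -> T (v i) = w i *: v i) ->
  V (\sum_(i <- r) v i) -> forall i, i \in r -> V (v i).
Proof.
move=> hV VT; elim: r v => [|i0 r IHr] v //= /andP[i0r ur] winj Tv Vs.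
have Vr i : i \in r -> V (v i).
  move=> ir; have wi : w i - w i0 != 0.
    rewrite subr_eq0; apply/eqP => /winj Ei.
    by move: i0r; rewrite -Ei ?ir // inE ?ir ?eqxx ?orbT.
  apply/(subspaceZ_eq hV _ wi); move: i ir {wi}.
  apply: IHr => // [i j ir jr|i ir|].
  - by apply: winj; rewrite inE (ir, jr) orbT.
  - have := linT (w i - w i0) (v i) 0.
    by rewrite T0 !addr0 => ->; rewrite Tv 1?inE ?ir ?orbT // !scalerA mulrC.
  - have -> : \sum_(i <- r) (w i - w i0) *: v i =
        T (\sum_(i <- i0 :: r) v i) - w i0 *: \sum_(i <- i0 :: r) v i.
      rewrite T_sum !big_cons Tv ?mem_head // scalerDr opprD addrACA subrr add0r.
      rewrite scaler_sumr -sumrB !big_seq; apply: eq_bigr => i ir.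
      by rewrite scalerBl Tv // inE ir orbT.
    by apply: subspaceB => //; [apply: VT|apply: subspaceZ].
move=> i; rewrite inE => /orP[/eqP->|]; last exact: Vr.
move: Vs; rewrite big_cons subspace_addr // big_seq.
by apply: subspace_sum => // j; apply: Vr.
Qed.

Definition eigen_sum (f : M) : Prop :=
  exists2 l : seq (k * M), forall p, p \in l -> T p.2 = p.1 *: p.2 &
    f = \sum_(p <- l) p.2.

Lemma eigen_sum0 : eigen_sum 0.
Proof. by exists [::]; rewrite ?big_nil. Qed.

Lemma eigen_sum1 c f : T f = c *: f -> eigen_sum f.
Proof. by move=> Tf; exists [:: (c, f)]; rewrite ?big_seq1 // => p; rewrite inE => /eqP->. Qed.

Lemma eigen_sumD f g : eigen_sum f -> eigen_sum g -> eigen_sum (f + g).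
Proof.
move=> [l Tl ->] [l' Tl' ->]; exists (l ++ l'); rewrite ?big_cat // => p.
by rewrite mem_cat => /orP[]; [apply: Tl|apply: Tl'].
Qed.

Lemma eigen_sum_ind (V Pr : set M) :
  subspace V -> (forall u, V u -> V (T u)) -> (forall f, V f -> eigen_sum f) ->
  Pr 0 -> (forall f g, Pr f -> Pr g -> Pr (f + g)) ->
  (forall c f, V f -> T f = c *: f -> f != 0 -> Pr f) ->
  forall f, V f -> Pr f.
Proof.
move=> hV VT sumV Pr0 PrD Pr1 f Vf; have [l Tl Ef] := sumV f Vf.
(* The given summands need not lie in [V]; once those with equal eigenvalue are collected,
   [eigen_components] applies. *)
pose v c := \sum_(p <- l | p.1 == c) p.2.
have Tv c : T (v c) = c *: v c.
  rewrite /v -big_filter T_sum scaler_sumr !big_seq; apply: eq_bigr => p.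
  by rewrite mem_filter => /andP[/eqP <- /Tl].
have Efv : f = \sum_(c <- undup (map fst l)) v c.
  rewrite /v (exchange_big_dep predT) //= Ef !big_seq; apply: eq_bigr => p pl.
  rewrite big_mkcond (bigD1_seq p.1) ?undup_uniq ?mem_undup ?map_f //= eqxx.
  by rewrite big1 ?addr0 // => c; rewrite eq_sym => /negPf->.
have Vv c : c \in undup (map fst l) -> V (v c).
  apply: (@eigen_components V _ _ id) => //; rewrite ?undup_uniq -?Efv //.
rewrite Efv big_seq; apply: big_ind => // c cl.
by have [->//|v0] := eqVneq (v c) 0; apply: Pr1 (Tv c) v0; apply: Vv.
Qed.

End Eigen.

Section MaximalIdeal.
Context (A : nzRingType) (ideal : set A -> Prop).

(** Without a maximal member, dependent choice would build a strictly ascending chain. *)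
Lemma acc_maximal (F : set (set A)) : acc ideal -> F `<=` ideal -> F !=set0 ->
  exists2 J, F J & forall J', F J' -> J `<=` J' -> J' = J.
Proof.
move=> accI FI [J0 FJ0]; apply: contrapT => nomax.
have step (J : {J | F J}) : {J' : {J | F J} | sval J `<=` sval J' & sval J' <> sval J}.
  apply: cid2; apply: contrapT => noJ'; apply: nomax; exists (sval J); first exact: svalP.
  move=> J' FJ' JJ'; apply: contrapT => neJ; apply: noJ'.
  by exists (exist _ J' FJ').
pose I := fix I i := if i is i'.+1 then s2val (step (I i')) else exist _ J0 FJ0 : {J | F J}.
have [N NI] := accI (fun i => sval (I i)) (fun i => FI _ (svalP (I i)))
  (fun i => s2valP (step (I i))).
exact: (s2valP' (step (I N)) (NI N.+1 (leqnSn N))).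
Qed.

End MaximalIdeal.

(** * Ore extensions *)

Section Ore.
Context (k : fieldType) (R S : algType k) (iota : {lrmorphism R -> S}) (x : S).
Context (tau : {lrmorphism R -> R}) (tauV : R -> R) (delta : {linear R -> R}).
Hypothesis hO : ore_extension iota x tau tauV delta.

(** A polynomial serves as a container for the left coefficients of [f]. Left multiplication by [R]
    and right multiplication by [x] are those of [{poly R}]; left multiplication by [x] is not
    ([coxM]). *)
Definition co (f : S) : {poly R} :=
  xget 0 [set p : {poly R} | \sum_(i < size p) iota p`_i * x ^+ i = f].

Lemma horner_iota (p : {poly R}) :
  (map_poly iota p).[x] = \sum_(i < size p) iota p`_i * x ^+ i.
Proof.
rewrite (horner_coef_wide _ (size_poly _ _)).
by apply: eq_bigr => i _; rewrite coef_map.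
Qed.

Lemma coE f : (map_poly iota (co f)).[x] = f.
Proof.
rewrite horner_iota /co; case: xgetP => // nof.
have [g _ gK] := ore_basis hO.
by have := nof (g f); rewrite /= gK.
Qed.

Lemma co_horner p : co (map_poly iota p).[x] = p.
Proof.
have /bij_inj inj := ore_basis hO.
by apply: inj; rewrite -!horner_iota coE.
Qed.

Lemma co_inj : injective co. Proof. by move=> f g Efg; rewrite -[f]coE Efg coE. Qed.

Lemma co_sumE f n : (size (co f) <= n)%N ->
  f = \sum_(i < n) iota (co f)`_i * x ^+ i.
Proof.
move=> szn; rewrite -{1}[f]coE (horner_coef_wide _ (leq_trans (size_poly _ _) szn)).
by apply: eq_bigr => i _; rewrite coef_map.
Qed.

Lemma coD f g : co (f + g) = co f + co g.
Proof. by rewrite -{1}[f]coE -{1}[g]coE -hornerD -rmorphD co_horner. Qed.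

Lemma co0 : co 0 = 0. Proof. by apply: (addrI (co 0)); rewrite -coD !addr0. Qed.

Lemma coN f : co (- f) = - co f.
Proof. by apply: (addrI (co f)); rewrite -coD !subrr co0. Qed.

Lemma coB f g : co (f - g) = co f - co g. Proof. by rewrite coD coN. Qed.

Lemma co_sum I (r : seq I) (P : pred I) F :
  co (\sum_(i <- r | P i) F i) = \sum_(i <- r | P i) co (F i).
Proof. exact: (big_morph co coD co0). Qed.

Lemma co_iotaM r f : co (iota r * f) = r%:P * co f.
Proof. by rewrite -{1}[f]coE -hornerCM -map_polyC -rmorphM co_horner. Qed.

Lemma coMx f : co (f * x) = co f * 'X.
Proof. by rewrite -{1}[f]coE -hornerMX -(map_polyX iota) -rmorphM co_horner. Qed.

Lemma coMxn f n : co (f * x ^+ n) = co f * 'X^n.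
Proof.
elim: n => [|n IHn]; first by rewrite !expr0 !mulr1.
by rewrite !exprSr !mulrA coMx IHn.
Qed.

Lemma co_iota r : co (iota r) = r%:P.
Proof. by rewrite -(hornerC (iota r) x) -map_polyC co_horner. Qed.

Lemma co_x : co x = 'X.
Proof. by rewrite -[x]mul1r -(rmorph1 iota) coMx co_iota mul1r. Qed.

Lemma scale_iota (a : k) (f : S) : a *: f = iota a%:A * f.
Proof. by rewrite linearZ /= rmorph1 mulr_algl. Qed.

Lemma coZ (a : k) f i : (co (a *: f))`_i = a *: (co f)`_i.
Proof. by rewrite scale_iota co_iotaM coefCM mulr_algl. Qed.

Lemma co_poly n (E : nat -> R) :
  co (\sum_(i < n) iota (E i) * x ^+ i) = \poly_(i < n) E i.
Proof.
rewrite co_sum poly_def; apply: eq_bigr => i _.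
by rewrite co_iotaM -[x ^+ i]mul1r coMxn -(rmorph1 iota) co_iota mul1r mul_polyC.
Qed.

Lemma iota_inj : injective iota.
Proof. by move=> r r' /(congr1 co); rewrite !co_iota => /polyC_inj. Qed.

Lemma coxM f : co (x * f) = map_poly tau (co f) * 'X + map_poly delta (co f).
Proof.
rewrite -[RHS]co_horner; congr co; rewrite -{1}[f]coE.
rewrite rmorphD rmorphM /= map_polyX hornerD hornerMX.
elim/poly_ind: (co f) => [|p c IHp].
  by rewrite !raddf0 !horner0 mulr0 mul0r addr0.
rewrite !rmorphD !raddfD /= !rmorphM /= !map_polyX !map_polyC /=.
have -> : map_poly delta (p * 'X) = map_poly delta p * 'X.
  by apply/polyP => i; rewrite coef_map !coefMX; case: ifP; rewrite ?raddf0 ?coef_map.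
rewrite rmorphM /= map_polyX !(hornerD, hornerMX, hornerC) mulrDr mulrA IHp.
by rewrite (ore_comm hO) !mulrDl addrACA.
Qed.

Lemma coxM0 f : (co (x * f))`_0 = delta (co f)`_0.
Proof. by rewrite coxM coefD coefMX add0r coef_map. Qed.

Lemma coxMS f i : (co (x * f))`_i.+1 = tau (co f)`_i + delta (co f)`_i.+1.
Proof. by rewrite coxM coefD coefMX !coef_map. Qed.

Lemma size_coxM f n : (size (co f) <= n)%N -> (size (co (x * f)) <= n.+1)%N.
Proof.
move=> /leq_sizeP szf; apply/leq_sizeP => -[//|i] ni.
by rewrite coxMS !szf ?raddf0 ?addr0 // ltnW.
Qed.

Lemma co_xnM g n m : (size (co g) <= m.+1)%N ->
  (size (co (x ^+ n * g)) <= (n + m).+1)%N /\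
  (co (x ^+ n * g))`_(n + m) = iter n tau (co g)`_m.
Proof.
move=> szg; elim: n => [|n [szn topn]]; first by rewrite mul1r.
rewrite exprS -mulrA; split; first exact: size_coxM.
by rewrite addSn coxMS topn (leq_sizeP _ _ szn) ?raddf0 ?addr0.
Qed.

Lemma co_mul_top f g n m : (size (co f) <= n.+1)%N -> (size (co g) <= m.+1)%N ->
  (size (co (f * g)) <= (n + m).+1)%N /\
  (co (f * g))`_(n + m) = (co f)`_n * iter n tau (co g)`_m.
Proof.
move=> szf szg; have Efg : f * g = \sum_(i < n.+1) iota (co f)`_i * (x ^+ i * g).
  by rewrite {1}(co_sumE szf) mulr_suml; apply: eq_bigr => i _; rewrite mulrA.
have sz i : (size (co (x ^+ i * g)) <= (i + m).+1)%N := (co_xnM i szg).1.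
have coefs j : (co (f * g))`_j = \sum_(i < n.+1) (co f)`_i * (co (x ^+ i * g))`_j.
  by rewrite Efg co_sum coef_sum; apply: eq_bigr => i _; rewrite co_iotaM coefCM.
split.
  apply/leq_sizeP => j nmj; rewrite coefs big1 // => i _.
  rewrite (leq_sizeP _ _ (sz i)) ?mulr0 // (leq_trans _ nmj) // ltnS leq_add2r.
  by rewrite -ltnS.
rewrite coefs big_ord_recr /= big1 ?add0r; first by rewrite (co_xnM n szg).2.
by move=> i _; rewrite (leq_sizeP _ _ (sz i)) ?mulr0 // ltn_add2r.
Qed.

(** The constant coefficient of [x h] is a value of [delta], so modulo [P] only the constant term of
    [f] contributes to that of [f g]. *)
Lemma co_mul0 (P : set R) f g : two_sided_ideal P -> range delta `<=` P ->
  P ((co (f * g))`_0 - (co f)`_0 * (co g)`_0).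
Proof.
move=> [[P0 PD PM] _] Pd; have Pdelta r : P (delta r) by apply: Pd; exists r.
have -> : (co (f * g))`_0 =
    \sum_(i < (size (co f)).+1) (co f)`_i * (co (x ^+ i * g))`_0.
  rewrite {1}(co_sumE (leqnSn (size (co f)))) mulr_suml co_sum coef_sum.
  by apply: eq_bigr => i _; rewrite -mulrA co_iotaM coefCM.
rewrite big_ord_recl expr0 mul1r addrC addKr.
by apply: big_ind => // i _; apply: PM; rewrite exprS -mulrA coxM0.
Qed.

End Ore.

Section RingIdeal.
Context (A : nzRingType) (I : set A).
Hypothesis idealI : two_sided_ideal I.

Lemma tsideal0 : I 0. Proof. by case: idealI => -[]. Qed.

Lemma tsidealD a b : I a -> I b -> I (a + b).
Proof. by case: idealI => -[_ ID _] _; apply: ID. Qed.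

Lemma tsidealMl r a : I a -> I (r * a).
Proof. by case: idealI => -[_ _ IM] _; apply: IM. Qed.

Lemma tsidealMr r a : I a -> I (a * r).
Proof. by case: idealI => _ [_ _ IM]; apply: IM. Qed.

Lemma right_annihilator_ideal (K : set A) : (forall r a, K a -> K (a * r)) ->
  two_sided_ideal [set b | forall a, K a -> I (a * b)].
Proof.
move=> KM; pose J := [set b | forall a, K a -> I (a * b)].
have J0 : J 0 by move=> a _; rewrite mulr0; apply: tsideal0.
have JD b b' : J b -> J b' -> J (b + b').
  by move=> Jb Jb' a Ka; rewrite mulrDr; apply: tsidealD; [apply: Jb|apply: Jb'].
split; split=> // r b Jb a Ka; rewrite mulrA; first by apply: Jb; apply: KM.
by apply: tsidealMr; apply: Jb.
Qed.

End RingIdeal.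

Lemma preimage_ideal (A B : nzRingType) (f : {rmorphism A -> B}) (I : set B) :
  two_sided_ideal I -> two_sided_ideal (f @^-1` I).
Proof.
move=> iI; have I0 : (f @^-1` I) 0 by rewrite /preimage /= rmorph0; apply: tsideal0.
have ID a b : (f @^-1` I) a -> (f @^-1` I) b -> (f @^-1` I) (a + b).
  by rewrite /preimage /= rmorphD; apply: tsidealD.
by split; split=> // r a; rewrite /preimage /= rmorphM; [apply: tsidealMl|apply: tsidealMr].
Qed.

Section IdealFacts.
Context (k : fieldType) (A : algType k).

Lemma ideal_subspace (I : set A) : left_ideal I -> subspace I.
Proof.
case=> I0 ID IM; split=> // a u v Iu Iv.
by apply: ID => //; rewrite -mulr_algl; apply: IM.
Qed.

Lemma proper_ideal1 (I : set A) : left_ideal I -> I <> setT -> ~ I 1.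
Proof.
by case=> _ _ IM ne I1; apply: ne; apply/seteqP; split=> // a _; rewrite -[a]mulr1; apply: IM.
Qed.

Lemma completely_prime_prime (P : set A) : completely_prime P -> prime_ideal P.
Proof.
case=> Ppr Pcp; split=> // I J _ _ IJ.
have [|/existsNP[a /not_implyP[Ia nPa]]] := EM (I `<=` P); first by left.
by right=> b Jb; case: (Pcp a b (IJ a b Ia Jb)).
Qed.

End IdealFacts.

(** * The action of [H] on coefficients, and constant coefficients of [H]-stable ideals *)

Section Cauchon.
Context (k : fieldType) (R S : algType k) (iota : {lrmorphism R -> S}) (x : S).
Context (tau : {lrmorphism R -> R}) (tauV : R -> R) (delta : {linear R -> R}) (q : k).
Context (H : groupType) (act : H -> {lrmorphism S -> S}) (actR : H -> {lrmorphism R -> R}).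
Hypothesis hS : cauchon_extension iota x tau tauV delta q act actR.
Hypothesis htau : acts_diagonalizably tau.

Let hO := cau_ore hS.
Local Notation co := (co iota x).

Lemma actK h f : act h (act h^-1%g f) = f.
Proof. by have [act1 actM] := cau_action hS; rewrite -actM mulgV act1. Qed.

Lemma actKV h f : act h^-1%g (act h f) = f.
Proof. by rewrite -{2}[h]invgK actK. Qed.

Lemma act_inj h : injective (act h). Proof. exact: can_inj (actKV h). Qed.

Lemma actRK h r : actR h (actR h^-1%g r) = r.
Proof. by apply: (iota_inj hO); rewrite -!(cau_Rstable hS) actK. Qed.

Lemma weight_neq0 h c : act h x = c *: x -> c != 0.
Proof.
move=> hx; apply/eqP => c0.
have x0 : x = 0 by apply: (@act_inj h); rewrite hx c0 scale0r raddf0.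
by have /eqP := congr1 co x0; rewrite (co_x hO) (co0 hO) polyX_eq0.
Qed.

Lemma co_act h c f i : act h x = c *: x ->
  (co (act h f))`_i = c ^+ i *: actR h (co f)`_i.
Proof.
move=> hx; have -> : act h f = \sum_(j < size (co f)) iota (c ^+ j *: actR h (co f)`_j) * x ^+ j.
    rewrite {1}(co_sumE hO (leqnn (size (co f)))) rmorph_sum; apply: eq_bigr => j _.
    by rewrite rmorphM /= (cau_Rstable hS) rmorphXn /= hx exprZn linearZ /= -scalerAl -scalerAr.
rewrite (co_poly hO _ (fun j => c ^+ j *: actR h (co f)`_j)) coef_poly.
by case: ltnP => // szf; rewrite nth_default // raddf0 scaler0.
Qed.

(** Apply [h] to [x r = tau(r) x + delta(r)]: the coefficients of [x] give this identity, the
    constant ones give [delta_act]. *)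
Lemma twist_act h r : actR h (tau r) = tau (actR h r).
Proof.
have [c hx] := cau_eigen hS h; have c0 := weight_neq0 hx.
have := congr1 (fun f => (co f)`_1) (congr1 (act h) (ore_comm hO r)).
rewrite rmorphM /= hx (cau_Rstable hS) -scalerAl (coZ hO).
rewrite (co_act _ _ hx) (coD hO) coefD (coMx hO) coefMX !(co_iota hO) !coefC /= addr0 expr1.
by rewrite (coxMS hO) (co_iota hO) !coefC /= raddf0 addr0 => /(scalerI c0).
Qed.

Lemma delta_act h c r : act h x = c *: x -> actR h (delta r) = c *: delta (actR h r).
Proof.
move=> hx; have := congr1 (fun f => (co f)`_0) (congr1 (act h) (ore_comm hO r)).
rewrite rmorphM /= hx (cau_Rstable hS) -scalerAl (coZ hO).
rewrite (co_act _ _ hx) (coD hO) coefD (coMx hO) coefMX !(co_iota hO) !coefC /= add0r expr0 scale1r.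
by rewrite (coxM0 hO) (co_iota hO) !coefC.
Qed.

Lemma tau_inj : injective tau. Proof. exact: can_inj (ore_tauK hO). Qed.

Lemma eigen_sum_tau r : eigen_sum tau r.
Proof.
have [d [v [c [tv ->]]]] := htau r; apply: big_ind => [||i _].
- exact: eigen_sum0.
- exact: eigen_sumD.
- exact: eigen_sum1 (tv i).
Qed.

Section Twist.
Context (h0 : H) (lam : k).
Hypothesis h0R : forall r, actR h0 r = tau r.
Hypothesis h0x : act h0 x = lam *: x.
Hypothesis lam_nru : not_root_of_unity lam.

Let lam0 : lam != 0. Proof. exact: weight_neq0 h0x. Qed.

(** This makes the bare function [tauV] linear, and makes [H]-stable subsets of [R] stable under
    it. *)
Lemma tauVE r : tauV r = actR h0^-1%g r.
Proof. by apply: tau_inj; rewrite (ore_tauVK hO) -h0R actRK. Qed.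

Lemma weight_exp_neq i j : (i < j)%N -> lam ^+ i != lam ^+ j.
Proof.
move=> ij; rewrite -(subnK (ltnW ij)) exprD -subr_eq0 -{1}[lam ^+ i]mul1r -mulrBl.
by rewrite mulf_neq0 ?expf_neq0 // subr_eq0 eq_sym lam_nru // subn_gt0.
Qed.

Lemma eigen_sum_act f : eigen_sum (act h0) f.
Proof.
rewrite (co_sumE hO (leqnn (size (co f)))); apply: big_ind => [||i _].
- exact: eigen_sum0.
- exact: eigen_sumD.
have [l tl ->] := eigen_sum_tau (co f)`_i; rewrite rmorph_sum mulr_suml big_seq.
apply: big_ind => [||p pl]; [exact: eigen_sum0|exact: eigen_sumD|].
apply: (@eigen_sum1 _ _ _ (p.1 * lam ^+ i)).
rewrite rmorphM rmorphXn /= h0x (cau_Rstable hS) h0R tl // exprZn linearZ /=.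
by rewrite -scalerAl -scalerAr scalerA.
Qed.

Lemma co_eigen f c i : act h0 f = c *: f -> tau (co f)`_i = (c * lam ^- i) *: (co f)`_i.
Proof.
move=> hf; have := co_act f i h0x; rewrite hf (coZ hO) h0R => E.
by rewrite mulrC -scalerA E scalerA mulVf ?expf_neq0 // scale1r.
Qed.

(* Take an eigenvector g in Q of least degree N with g_0 outside P. Each step
   u |-> x u - mu u x that cancels the top coefficient moves the lowest
   coefficient outside P up by one, so N steps give u in Q of degree N with only
   p = u_N outside P. Then g p - c^N g_N u has degree < N, and its constant
   coefficient is g_0 p modulo P. *)
Lemma const_coef_in (Q : set S) (P : set R) :
  two_sided_ideal Q -> (forall f, Q f -> Q (act h0 f)) ->
  completely_prime P -> range delta `<=` P ->
  (forall r, Q (iota r) -> P r) -> forall f, Q f -> P (co f)`_0.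
Proof.
move=> iQ hQ [[iP _] cP] dP QP.
have sQ := ideal_subspace iQ.1; have sP := ideal_subspace iP.1.
have Pd r : P (delta r) by apply: dP; exists r.
suff main n f : Q f -> (size (co f) <= n.+1)%N -> P (co f)`_0.
  by move=> f Qf; apply: main Qf (leqnSn _).
elim: n f => [|n IHn] f Qf szf.
  apply: QP; have := co_sumE hO szf.
  by rewrite big_ord1 expr0 mulr1 => <-.
set N := n.+1 in szf *.
pose V := [set g | Q g /\ (size (co g) <= N.+1)%N].
suff: forall g, V g -> P (co g)`_0 by apply.
apply: (@eigen_sum_ind _ _ (act h0)) => [|||||| c g [Qg szg] hg g0].
- exact: linearP.
- split; first by split; [exact: subspace0|rewrite (co0 hO) size_poly0].
  move=> a u v [Qu szu] [Qv szv]; split; first exact: sQ.2.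
  apply/leq_sizeP => j Nj; rewrite (coD hO) coefD (coZ hO).
  by rewrite (leq_sizeP _ _ szu) // (leq_sizeP _ _ szv) // scaler0 addr0.
- move=> u [Qu szu]; split; first exact: hQ.
  by apply/leq_sizeP => j Nj; rewrite (co_act _ _ h0x) (leq_sizeP _ _ szu) // raddf0 scaler0.
- by move=> u _; apply: eigen_sum_act.
- by rewrite (co0 hO) coef0; apply: subspace0.
- by move=> u v Pu Pv; rewrite (coD hO) coefD; apply: subspaceD.
apply: contrapT => nPg.
have c0 : c != 0.
  apply/eqP => c0; move/eqP: g0; apply; apply: (@act_inj h0).
  by rewrite hg c0 scale0r raddf0.
have iterate m : (m <= N)%N -> exists g', [/\ Q g', (size (co g') <= N.+1)%N,
    act h0 g' = (c * lam ^+ m) *: g', forall i, (i < m)%N -> P (co g')`_i & ~ P (co g')`_m].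
  elim: m => [_|m IHm mN]; first by exists g; rewrite expr0 mulr1; split.
  have [u [Qu szu hu Pu nPu]] := IHm (ltnW mN).
  pose mu := c * lam ^+ m * lam ^- N.
  have coS i : (co (x * u - mu *: (u * x)))`_i.+1 =
      (c * lam ^+ m * (lam ^- i - lam ^- N)) *: (co u)`_i + delta (co u)`_i.+1.
    rewrite (coB hO) coefB (coxMS hO) (coZ hO) (coMx hO) coefMX /=.
    by rewrite (co_eigen _ hu) mulrBr scalerBl addrAC.
  exists (x * u - mu *: (u * x)); split.
  - by apply: subspaceB => //; [apply: tsidealMl|apply: subspaceZ => //; apply: tsidealMr].
  - apply/leq_sizeP => -[//|i]; rewrite ltnS leq_eqVlt => /orP[/eqP<-|Ni].
      by rewrite coS subrr mulr0 scale0r add0r (leq_sizeP _ _ szu) ?raddf0.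
    by rewrite coS !(leq_sizeP _ _ szu) ?scaler0 ?raddf0 ?addr0 // ltnW.
  - rewrite raddfB /= linearZ /= !rmorphM /= h0x hu -!scalerAl -!scalerAr !scalerA.
    have E : lam * (c * lam ^+ m) = c * (lam ^+ m * lam) by rewrite mulrC mulrA.
    have E' : mu * (c * lam ^+ m) * lam = c * (lam ^+ m * lam) * mu.
      by rewrite -mulrA mulrC -(mulrA c).
    by rewrite scalerBr !scalerA exprSr E E'.
  - move=> [_|i]; first by rewrite (coB hO) coefB (coxM0 hO) (coZ hO) (coMx hO) coefMX scaler0 subr0.
    by rewrite ltnS coS => im; apply: subspaceD => //; apply: subspaceZ => //; apply: Pu.
  - rewrite coS subspace_addr // subspaceZ_eq //.
    rewrite !mulf_neq0 ?expf_neq0 // subr_eq0 (inj_eq invr_inj).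
    exact: weight_exp_neq.
have [u [Qu szu hu Pu]] := iterate N (leqnn N).
set p := (co u)`_N => nPp.
(* The weight of [u] is [c lam^N], so its coefficient at [x^N] has [tau]-eigenvalue [c]. Moving [p]
   past [x^N] thus costs the factor [c^N] that appears in [v]. *)
have taup : tau p = c *: p by rewrite (co_eigen _ hu) mulfK ?expf_neq0.
have itaup i : iter i tau p = c ^+ i *: p.
  by elim: i => [|i /= ->]; rewrite ?scale1r // linearZ /= taup scalerA exprSr.
have szp : (size (co (iota p)) <= 1)%N by rewrite (co_iota hO) size_polyC; case: eqP.
have [szgp topgp] := co_mul_top hO szg szp.
pose v := g * iota p - c ^+ N *: (iota (co g)`_N * u).
have Qv : Q v.
  by apply: subspaceB => //; [apply: tsidealMr|apply: subspaceZ => //; apply: tsidealMl].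
have szv : (size (co v) <= n.+1)%N.
  apply/leq_sizeP => j; rewrite /v (coB hO) coefB (coZ hO) (co_iotaM hO) coefCM.
  rewrite leq_eqVlt => /orP[/eqP<-|nj].
    move: topgp; rewrite addn0 -/N => ->; rewrite (co_iota hO) coefC eqxx itaup.
    by rewrite -scalerAr subrr.
  by rewrite (leq_sizeP _ _ szgp) ?addn0 // (leq_sizeP _ _ szu) // mulr0 scaler0 subr0.
have := IHn v Qv szv.
rewrite /v (coB hO) coefB (coZ hO) (co_iotaM hO) coefCM addrC subspace_addl //; last first.
  by rewrite -scaleN1r; do 2!apply: subspaceZ => //; apply: (tsidealMl iP); apply: Pu.
have := co_mul0 hO g (iota p) iP dP; rewrite (co_iota hO) coefC /= => Pgp.
rewrite -[(co (g * _))`_0](subrK ((co g)`_0 * p)) subspace_addl //.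
by case/cP.
Qed.

End Twist.

End Cauchon.

(** * The deleting-derivation homomorphism *)

Section Deleting.
Context (k : fieldType) (R S : algType k) (iota : {lrmorphism R -> S}) (x : S).
Context (tau : {lrmorphism R -> R}) (tauV : R -> R) (delta : {linear R -> R}) (q : k).
Context (H : groupType) (act : H -> {lrmorphism S -> S}) (actR : H -> {lrmorphism R -> R}).
Hypothesis hS : cauchon_extension iota x tau tauV delta q act actR.
Hypothesis htau : acts_diagonalizably tau.
Context (h0 : H) (lam : k).
Hypothesis h0R : forall r, actR h0 r = tau r.
Hypothesis h0x : act h0 x = lam *: x.
Hypothesis lam_nru : not_root_of_unity lam.
Context (L : unitAlgType k) (j : {lrmorphism S -> L}).
Hypothesis hL : localization_at_powers x j.

Let hO := cau_ore hS.
Local Notation co := (co iota x).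
Local Notation X := (j x).
Local Notation C := (cauchonC iota x tauV delta q j).
Local Notation dt l r := (iter l delta (iter l tauV r)).

Let uX : X \is a GRing.unit := loc_unit hL.
Let tauVE r : tauV r = actR h0^-1%g r := tauVE hS h0R r.

Lemma loc_inj : injective j.
Proof.
move=> f g /eqP; rewrite -subr_eq0 -raddfB => /eqP/(loc_ker hL)[i].
move/(congr1 co); rewrite (coMxn hO) (co0 hO) => E; apply/eqP; rewrite -subr_eq0.
apply/eqP/(co_inj hO); rewrite (co0 hO); apply/polyP => n.
by have := congr1 (fun p : {poly R} => p`_(n + i)) E; rewrite coefMXn ltnNge leq_addl addnK !coef0.
Qed.

Lemma iter_delta0 n l r : iter n delta r = 0 -> (n <= l)%N -> iter l delta r = 0.
Proof.
move=> nr /subnK <-; rewrite iterD nr; elim: (l - n)%N => //= m ->.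
exact: raddf0.
Qed.

Lemma iter_deltaZ l a r : iter l delta (a *: r) = a *: iter l delta r.
Proof. by elim: l => //= l ->; rewrite linearZ. Qed.

Lemma iter_deltaD l r r' : iter l delta (r + r') = iter l delta r + iter l delta r'.
Proof. by elim: l => //= l ->; rewrite raddfD. Qed.

Lemma iter_tauVD l r r' : iter l tauV (r + r') = iter l tauV r + iter l tauV r'.
Proof. by elim: l => //= l ->; rewrite !tauVE raddfD. Qed.

Lemma iter_tauVZ l a r : iter l tauV (a *: r) = a *: iter l tauV r.
Proof. by elim: l => //= l ->; rewrite !tauVE linearZ. Qed.

Lemma delta_tauV r : delta (tauV r) = q^-1 *: tauV (delta r).
Proof.
apply: (tau_inj hS); rewrite linearZ /= (ore_tauVK hO).
by rewrite -{2}(ore_tauVK hO r) (cau_comm hS) scalerA mulVf ?scale1r ?(cau_q0 hS).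
Qed.

Lemma iter_delta_tauV0 l m r : iter l delta r = 0 -> iter l delta (iter m tauV r) = 0.
Proof.
move=> lr; have tauV0 : tauV 0 = 0 by rewrite tauVE raddf0.
have step r' : iter l delta (tauV r') = q ^- l *: tauV (iter l delta r').
  elim: l {lr} => [|l IHl] /=; first by rewrite expr0 invr1 scale1r.
  by rewrite IHl linearZ /= delta_tauV scalerA -invfM -exprSr.
by elim: m => //= m IHm; rewrite step IHm tauV0 scaler0.
Qed.

Lemma cauchonC_sum n r : iter n delta r = 0 ->
  C r = \sum_(l < n) qcoef q l *: (j (iota (dt l r)) * X ^- l).
Proof.
move=> nr; rewrite (fsbig_ord _ n (fun l => qcoef q l *: (j (iota (dt l r)) * X ^- l))).
rewrite /cauchonC; apply/esym; apply: fsbig_widen => // l [_ /= nl].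
rewrite (@iter_delta0 n) ?raddf0 ?mul0r ?scaler0 //; first exact: iter_delta_tauV0.
by rewrite leqNgt; apply/negP.
Qed.

Lemma nilp2 r r' : exists n, iter n delta r = 0 /\ iter n delta r' = 0.
Proof.
have [n nr] := cau_nilp hS r; have [n' nr'] := cau_nilp hS r'.
by exists (n + n')%N; split; [apply: iter_delta0 nr _|apply: iter_delta0 nr' _];
  rewrite ?leq_addr ?leq_addl.
Qed.

Lemma cauchonCD r r' : C (r + r') = C r + C r'.
Proof.
have [n [nr nr']] := nilp2 r r'.
rewrite !(@cauchonC_sum n) ?iter_deltaD ?nr ?nr' ?addr0 // -big_split /=.
by apply: eq_bigr => l _; rewrite iter_tauVD iter_deltaD !raddfD /= mulrDl scalerDr.
Qed.

Lemma cauchonCZ a r : C (a *: r) = a *: C r.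
Proof.
have [n nr] := cau_nilp hS r.
rewrite !(@cauchonC_sum n) ?iter_deltaZ ?nr ?scaler0 // scaler_sumr.
apply: eq_bigr => l _; rewrite iter_tauVZ iter_deltaZ !linearZ /= -scalerAl.
by rewrite !scalerA mulrC.
Qed.

Lemma cauchonC0 : C 0 = 0. Proof. by rewrite -(scale0r 0) cauchonCZ scale0r. Qed.

Lemma qcoef0 : qcoef q 0 = 1.
Proof. by rewrite /qcoef mul0n expr0 invr1 mulr1 /qfact big_geq // divr1. Qed.

Lemma delta1 : delta 1 = 0.
Proof.
have := ore_deriv hO 1 1; rewrite !mulr1 rmorph1 mul1r => /eqP.
by rewrite -subr_eq0 opprD addrA subrr add0r oppr_eq0 => /eqP.
Qed.

Lemma cauchonC1 : C 1 = 1.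
Proof.
rewrite (@cauchonC_sum 1%N 1 delta1) // big_ord1 qcoef0 scale1r.
by rewrite expr0 invr1 mulr1 !rmorph1.
Qed.

(** The origin of the constants [q_l]: comparing coefficients of [x^-l] in [x C(r) = C(tau r) x]
    yields this recursion. *)
Lemma qcoefS l : qcoef q l.+1 = qcoef q l + qcoef q l.+1 / q ^+ l.+1.
Proof.
have q0 := cau_q0 hS; have qn i : (0 < i)%N -> q ^+ i - 1 != 0.
  by move=> i0; rewrite subr_eq0 (cau_q hS).
have q1 : q - 1 != 0 by have := qn 1%N isT; rewrite expr1.
have fact0 n : qfact q n != 0.
  rewrite /qfact big_add1 /= prodf_seq_neq0; apply/allP => i _ /=.
  by rewrite mulf_neq0 ?invr_eq0 ?qn.
have E : qcoef q l.+1 * (1 - q ^- l.+1) = qcoef q l.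
  rewrite /qcoef.
  have -> : (l.+1 * l.+2)./2 = ((l * l.+1)./2 + l.+1)%N.
    have -> : (l.+1 * l.+2 = l * l.+1 + l.+1.*2)%N.
      by rewrite -muln2 (mulnC l) -mulnDr addn2.
    by rewrite halfD odd_double andbF add0n doubleK.
  have -> : qfact q l.+1 = qfact q l * ((q ^+ l.+1 - 1) / (q - 1)).
    by rewrite /qfact big_nat_recr.
  rewrite exprD; have := qn l.+1 isT; have := expf_neq0 l q1; have := expf_neq0 l.+1 q0.
  have := fact0 l; rewrite [in (q - 1) ^- l.+1]exprSr.
  move: (q - 1) q1 ((q - 1) ^+ l) (qfact q l) (q ^+ l.+1) => D D0 Dl F Q F0 Q0 Dl0 Q1.
  by field; rewrite F0 Q0 Dl0 Q1 D0.
by rewrite -{1}E mulrBr mulr1 subrK.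
Qed.

Lemma iter_tau_delta l r : iter l delta (tau r) = q ^+ l *: tau (iter l delta r).
Proof.
elim: l => [|l IHl] /=; first by rewrite scale1r.
by rewrite IHl linearZ /= (cau_comm hS) scalerA exprSr.
Qed.

Lemma X_iota r : X * j (iota r) = j (iota (tau r)) * X + j (iota (delta r)).
Proof. by rewrite -rmorphM (ore_comm hO) rmorphD rmorphM. Qed.

Lemma X_cauchonC r : X * C r = C (tau r) * X.
Proof.
have [n nr] := cau_nilp hS r.
have nr1 : iter n.+1 delta r = 0 by apply: iter_delta0 nr _.
have ntr : iter n.+1 delta (tau r) = 0 by rewrite iter_tau_delta nr1 raddf0 scaler0.
rewrite (cauchonC_sum nr) (cauchonC_sum ntr) mulr_sumr mulr_suml.
pose b l := iter l delta (iter l tauV (tau r)).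
have bS l : b l.+1 = delta (dt l r) by rewrite /b [iter l.+1 tauV _]iterSr (ore_tauK hO).
have tdt l : tau (dt l r) = q ^- l *: b l.
  have tauVr m : iter m tauV (tau r) = tau (iter m tauV r).
    by elim: m => //= m ->; rewrite (ore_tauK hO) (ore_tauVK hO).
  rewrite /b tauVr iter_tau_delta scalerA mulVf ?scale1r // expf_neq0 //.
  exact: cau_q0 hS.
have bn : b n = 0 by apply: iter_delta_tauV0; rewrite iter_tau_delta nr raddf0 scaler0.
(* [F l] is the [tau]-part and [G l] the [delta]-part of [x] times the [l]-th term of [C r]; [G l]
   and [F l.+1] carry the same power of [x]. *)
pose F l : L := (qcoef q l / q ^+ l) *: (j (iota (b l)) * X ^- l * X).
pose G l : L := qcoef q l *: (j (iota (b l.+1)) * X ^- l).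
transitivity (\sum_(l < n) (F l + G l)).
  apply: eq_bigr => l _.
  have cXV : X ^- l * X = X * X ^- l.
    by apply/esym/commrV/commrX/commr_refl.
  rewrite -scalerAr mulrA X_iota mulrDl scalerDr /F /G bS tdt !linearZ /=.
  by rewrite -!scalerAl scalerA -!mulrA cXV.
have -> : \sum_(l < n) (F l + G l) = F 0%N + \sum_(l < n) (G l + F l.+1).
  rewrite !big_split /= [RHS]addrCA addrC; congr (_ + _).
  have -> : F 0%N + \sum_(l < n) F l.+1 = \sum_(l < n.+1) F l by rewrite big_ord_recl.
  by rewrite big_ord_recr /= /F bn !raddf0 !mul0r scaler0 addr0.
rewrite big_ord_recl; congr (_ + _).
  by rewrite /F expr0 invr1 mulr1 -scalerAl.
apply: eq_bigr => l _.
rewrite /F /G lift0 -scalerAl [qcoef q l.+1 in RHS]qcoefS scalerDl; congr (_ *: _ + _).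
by rewrite exprS invrM ?unitrX // mulrA mulrVK.
Qed.

Lemma Xn_cauchonC n r : X ^+ n * C r = C (iter n tau r) * X ^+ n.
Proof.
elim: n => [|n IHn]; first by rewrite mul1r mulr1.
by rewrite exprS -mulrA IHn mulrA X_cauchonC -mulrA -exprS.
Qed.

(** This is [C r x^n] as an element of [S] once [delta^(n+1)] kills [r] ([j_gC]); with denominators
    cleared, coefficients and the action of [H] become available. *)
Definition gC (r : R) (n : nat) : S :=
  \sum_(i < n.+1) iota (qcoef q (n - i) *: dt (n - i)%N r) * x ^+ i.

Lemma co_gC r n i :
  (co (gC r n))`_i = if (i < n.+1)%N then qcoef q (n - i) *: dt (n - i)%N r else 0.
Proof.
by rewrite (co_poly hO _ (fun i => qcoef q (n - i) *: dt (n - i)%N r)) coef_poly.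
Qed.

Lemma size_gC r n : (size (co (gC r n)) <= n.+1)%N.
Proof. by apply/leq_sizeP => i ni; rewrite co_gC ltnNge ni. Qed.

Lemma gC_top r n : (co (gC r n))`_n = r.
Proof. by rewrite co_gC ltnSn subnn qcoef0 scale1r. Qed.

Lemma j_gC r n : iter n.+1 delta r = 0 -> j (gC r n) = C r * X ^+ n.
Proof.
move=> nr; rewrite (cauchonC_sum nr) mulr_suml rmorph_sum /=.
rewrite (reindex_inj rev_ord_inj) /=; apply: eq_bigr => l _.
have ln : (l <= n)%N by rewrite -ltnS.
rewrite subSS (subKn ln) rmorphM rmorphXn /= linearZ /= linearZ /= -!scalerAl.
have -> : X ^+ n = X ^+ l * X ^+ (n - l) by rewrite -exprD subnKC.
by rewrite mulrA mulrVK ?unitrX.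
Qed.

Lemma gCZ a r n : gC (a *: r) n = a *: gC r n.
Proof.
apply: (co_inj hO); apply/polyP => i; rewrite (coZ hO) !co_gC.
by case: ifP; rewrite ?scaler0 // iter_tauVZ iter_deltaZ !scalerA mulrC.
Qed.

Lemma x_gC r n : iter n.+1 delta r = 0 -> x * gC r n = gC (tau r) n * x.
Proof.
move=> nr; apply: loc_inj; rewrite !rmorphM /= !j_gC //.
  by rewrite mulrA X_cauchonC -!mulrA -exprS -exprSr.
by rewrite iter_tau_delta nr raddf0 scaler0.
Qed.

Lemma actR_iter_delta h c l r : act h x = c *: x ->
  actR h (iter l delta r) = c ^+ l *: iter l delta (actR h r).
Proof.
move=> hx; elim: l => [|l IHl] /=; first by rewrite scale1r.
by rewrite (delta_act hS _ hx) IHl linearZ /= scalerA exprS.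
Qed.

Lemma act_gC h c r n : act h x = c *: x -> act h (gC r n) = c ^+ n *: gC (actR h r) n.
Proof.
move=> hx; apply: (co_inj hO); apply/polyP => i.
rewrite (co_act hS _ _ hx) (coZ hO) !co_gC; case: ltnP => [|_]; last first.
  by rewrite raddf0 !scaler0.
rewrite ltnS => ni; rewrite linearZ /= !scalerA.
have htV l r' : actR h (iter l tauV r') = iter l tauV (actR h r').
  elim: l => //= l IHl; apply: (tau_inj hS).
  by rewrite -(twist_act hS) !(ore_tauVK hO).
rewrite (actR_iter_delta _ _ hx) htV scalerA mulrAC -exprD addnC subnK // mulrC.
Qed.

(** If [g] had degree [m], its top coefficient would have [tau]-eigenvalue [c] by the commutation
    with [x] and [c lam^(n-m)] by the weight. As [lam] is not a root of unity this forces [m = n],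
    against the size bound. *)
Lemma weight_unique g c n : (size (co g) <= n)%N ->
  x * g = c *: (g * x) -> act h0 g = (c * lam ^+ n) *: g -> g = 0.
Proof.
move=> szg xg hg; apply/(co_inj hO); rewrite (co0 hO).
apply/eqP; rewrite -size_poly_leq0 leqNgt; apply/negP => sz0.
set p := co g in szg sz0 *; pose m := (size p).-1.
have szm : size p = m.+1 by rewrite prednK.
have pm : p`_m != 0 by rewrite -lead_coefE lead_coef_eq0 -size_poly_gt0.
have E1 : tau p`_m = c *: p`_m.
  have := congr1 (fun f => (co f)`_m.+1) xg.
  by rewrite (coxMS hO) (coZ hO) (coMx hO) coefMX [p`_m.+1]nth_default ?szm // raddf0 addr0.
have := co_eigen hS h0R h0x m hg; rewrite -/p E1 => /eqP.
rewrite -subr_eq0 -scalerBl scaler_eq0 (negPf pm) orbF.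
have c0 : c != 0.
  apply/eqP => c0; move/eqP: pm; apply; apply: (tau_inj hS).
  by rewrite E1 c0 scale0r raddf0.
rewrite -mulrA -{1}[c]mulr1 -mulrBr mulf_eq0 (negPf c0) /= subr_eq0.
rewrite eq_sym -(inj_eq (mulIf (expf_neq0 m (weight_neq0 hS h0x)))) mulfVK ?expf_neq0 ?(weight_neq0 hS h0x) //.
by rewrite mul1r eq_sym; apply/negP/(weight_exp_neq hS h0x lam_nru); rewrite -szm.
Qed.

(* For tau-eigenvectors, C (r r') and C r C r' have the same leading term, weight
   and commutation with x, which determine them by weight_unique. *)
Lemma cauchonCM r r' : C (r * r') = C r * C r'.
Proof.
have eig : forall s, setT s -> eigen_sum tau s by move=> s _; apply: eigen_sum_tau.
have subT : subspace [set: R] by split.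
have taul := linearP tau.
suff: [set s | C (s * r') = C s * C r'] r by [].
apply: (eigen_sum_ind taul subT (fun _ _ => Logic.I) eig) => //= [|s s' Es Es'|c {}r _ tr _].
- by rewrite !mul0r cauchonC0 mul0r.
- by rewrite mulrDl !cauchonCD Es Es' mulrDl.
suff: [set s | C (r * s) = C r * C s] r' by [].
apply: (eigen_sum_ind taul subT (fun _ _ => Logic.I) eig) => //= [|s s' Es Es'|c' {}r' _ tr' r'0].
- by rewrite !mulr0 cauchonC0 mulr0.
- by rewrite mulrDr !cauchonCD Es Es' mulrDr.
have c'0 : c' != 0.
  apply/eqP => c'0; move/eqP: r'0; apply; apply: (tau_inj hS).
  by rewrite tr' c'0 scale0r raddf0.
have itr n : iter n tau r' = c' ^+ n *: r'.
  by elim: n => [|n /= ->]; rewrite ?scale1r // linearZ /= tr' scalerA exprSr.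
have [n0 [nr0 nr'0]] := nilp2 r r'; have [n1 nrr1] := cau_nilp hS (r * r').
pose n := (n0 + n1)%N.
have nr : iter n.+1 delta r = 0 by apply: iter_delta0 nr0 _; rewrite ltnW // ltnS leq_addr.
have nr' : iter n.+1 delta r' = 0 by apply: iter_delta0 nr'0 _; rewrite ltnW // ltnS leq_addr.
have nrr : iter (n + n).+1 delta (r * r') = 0.
  by apply: iter_delta0 nrr1 _; rewrite ltnW // ltnS -addnA addnCA leq_addr.
have trr : tau (r * r') = (c * c') *: (r * r').
  by rewrite rmorphM /= tr tr' -scalerAl -scalerAr scalerA.
have x_eig s d m : tau s = d *: s -> iter m.+1 delta s = 0 -> x * gC s m = d *: (gC s m * x).
  by move=> ts ms; rewrite x_gC // ts gCZ -scalerAl.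
have act_eig s d m : tau s = d *: s -> act h0 (gC s m) = (d * lam ^+ m) *: gC s m.
  by move=> ts; rewrite (act_gC _ _ h0x) h0R ts gCZ scalerA mulrC.
(* Moving [x^n] past [r'] produces [c'^n]; with this factor the coefficients at [x^(n+n)] cancel. *)
pose g := gC r n * gC r' n - c' ^+ n *: gC (r * r') (n + n).
have g0 : g = 0.
  apply: (@weight_unique g (c * c') (n + n)).
  - have [sz top] := co_mul_top hO (size_gC r n) (size_gC r' n).
    apply/leq_sizeP => i; rewrite leq_eqVlt (coB hO) coefB (coZ hO) => /orP[/eqP<-|ni].
      by rewrite top !gC_top itr -scalerAr subrr.
    by rewrite (leq_sizeP _ _ sz) // (leq_sizeP _ _ (size_gC _ _)) // scaler0 subr0.
  - rewrite mulrBr mulrA (x_eig r c) // -scalerAl -mulrA (x_eig r' c') // -!scalerAr (x_eig _ (c * c')) //.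
    rewrite mulrBl -!scalerAl !scalerA scalerBr scalerA mulrA.
    by congr (_ - _ *: _); rewrite mulrC.
  - rewrite raddfB /= linearZ /= rmorphM /= (act_eig r c n) // (act_eig r' c' n) // (act_eig _ (c * c') (n + n)%N) //.
    rewrite -scalerAl -scalerAr !scalerA scalerBr scalerA; congr (_ *: _ - _ *: _).
      by rewrite exprD mulrACA.
    by rewrite mulrC.
have := congr1 j g0; rewrite /g raddf0 raddfB /= linearZ /= rmorphM /= !j_gC // => /eqP.
rewrite subr_eq0 -mulrA [X ^+ n * _]mulrA Xn_cauchonC itr cauchonCZ -!scalerAl -scalerAr.
rewrite -(inj_eq (scalerI (invr_neq0 (expf_neq0 n c'0)))) !scalerK ?expf_neq0 //.
rewrite exprD !mulrA => /eqP/(mulIr (unitrX n uX))/(mulIr (unitrX n uX)) //.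
Qed.

(** * Laurent polynomials in [x] over the image of [C] *)

Implicit Types p u : {poly R}.

Definition EC p : L := \sum_(i < size p) C p`_i * X ^+ i.

Lemma EC_wide n p : (size p <= n)%N -> EC p = \sum_(i < n) C p`_i * X ^+ i.
Proof.
move=> szn; rewrite /EC (big_ord_widen _ (fun i => C p`_i * X ^+ i) szn).
rewrite big_mkcond; apply: eq_bigr => i _; case: ltnP => // szi.
by rewrite nth_default // cauchonC0 mul0r.
Qed.

Lemma ECD p p' : EC (p + p') = EC p + EC p'.
Proof.
rewrite !(@EC_wide (maxn (size p) (size p'))) ?leq_maxl ?leq_maxr ?size_polyD //.
by rewrite -big_split; apply: eq_bigr => i _; rewrite coefD cauchonCD mulrDl.
Qed.

Lemma EC0 : EC 0 = 0. Proof. by rewrite /EC size_poly0 big_ord0. Qed.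

Lemma EC_sum I (s : seq I) (P : pred I) F :
  EC (\sum_(i <- s | P i) F i) = \sum_(i <- s | P i) EC (F i).
Proof. exact: (big_morph EC ECD EC0). Qed.

Lemma EC_Xn p m : EC (p * 'X^m) = EC p * X ^+ m.
Proof.
elim: m => [|m IHm]; first by rewrite !mulr1.
rewrite !exprSr !mulrA -{}IHm; set u := p * _.
rewrite (@EC_wide (size u).+1) ?(leq_trans (size_polyMleq _ _)) ?size_polyX ?addn2 //.
rewrite big_ord_recl coefMX eqxx cauchonC0 mul0r add0r mulr_suml.
by apply: eq_bigr => i _; rewrite lift0 coefMX /= exprSr mulrA.
Qed.

Lemma EC_C r : EC r%:P = C r.
Proof.
by rewrite (@EC_wide 1%N) ?size_polyC ?leq_b1 // big_ord1 coefC mulr1.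
Qed.

Lemma C_EC r p : C r * EC p = EC (r%:P * p).
Proof.
rewrite (@EC_wide (size p) (r%:P * p)); last first.
  by apply/leq_sizeP => i szi; rewrite coefCM nth_default ?mulr0.
by rewrite mulr_sumr; apply: eq_bigr => i _; rewrite coefCM cauchonCM mulrA.
Qed.

Lemma X_EC p : X * EC p = EC (map_poly tau p) * X.
Proof.
rewrite (@EC_wide (size p) (map_poly tau p)) ?size_poly // mulr_sumr mulr_suml.
apply: eq_bigr => i _; rewrite coef_map mulrA X_cauchonC -!mulrA.
by rewrite -exprS -exprSr.
Qed.

Lemma Xn_EC n p : X ^+ n * EC p = EC (iter n (map_poly tau) p) * X ^+ n.
Proof.
elim: n => [|n IHn]; first by rewrite mul1r mulr1.
by rewrite exprS -mulrA IHn mulrA X_EC -mulrA.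
Qed.

Lemma coef_iter_map n p i : (iter n (map_poly tau) p)`_i = iter n tau p`_i.
Proof. by elim: n => //= n IHn; rewrite coef_map IHn. Qed.

Lemma iter_tauVK n r : iter n tau (iter n tauV r) = r.
Proof. by elim: n => // n IHn; rewrite iterSr /= (ore_tauVK hO). Qed.

Lemma nilp_poly (p : {poly R}) : exists n, forall i, iter n.+1 delta p`_i = 0.
Proof.
elim/poly_ind: p => [|p c [n IHp]].
  by exists 0%N => i; rewrite coef0 /= raddf0.
have [m cm] := cau_nilp hS c; exists (n + m)%N => i.
rewrite coefD coefMX coefC; case: i => [|i] /=.
  by rewrite add0r -iterS; apply: (@iter_delta0 m _ _ cm); rewrite ltnW // ltnS leq_addl.
by rewrite addr0 -iterS; apply: (@iter_delta0 n.+1 _ _ (IHp i)); rewrite ltnS leq_addr.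
Qed.

Definition ECg p n : S := \sum_(i < size p) gC p`_i n * x ^+ i.

Lemma j_ECg p n : (forall i, iter n.+1 delta p`_i = 0) -> j (ECg p n) = EC p * X ^+ n.
Proof.
move=> pn; rewrite /EC mulr_suml rmorph_sum; apply: eq_bigr => i _.
by rewrite rmorphM rmorphXn /= j_gC // -!mulrA -!exprD addnC.
Qed.

Lemma ECg_top p n m : size p = m.+1 -> (co (ECg p n))`_(n + m) = p`_m.
Proof.
move=> szm; rewrite (co_sum hO) coef_sum szm big_ord_recr /= big1 => [|i _].
  by rewrite add0r (coMxn hO) coefMXn ltnNge leq_addl /= addnK gC_top.
rewrite (coMxn hO) coefMXn; case: ltnP => // _; rewrite co_gC ltnNge.
by rewrite -addnBA ?(ltnW (ltn_ord i)) // -addn1 leq_add2l subn_gt0 ltn_ord.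
Qed.

(** Multiplied by a power of [x], [EC p] lies in [S], where the leading coefficient of [p] is still
    visible. *)
Lemma EC_eq0 p : EC p = 0 -> p = 0.
Proof.
move=> p0; apply/eqP; rewrite -size_poly_leq0 leqNgt; apply/negP => szp.
have szm : size p = (size p).-1.+1 by rewrite prednK.
have [n pn] := nilp_poly p; have := ECg_top n szm.
have -> : ECg p n = 0 by apply: loc_inj; rewrite raddf0 j_ECg // p0 mul0r.
rewrite (co0 hO) coef0 => /esym/eqP; rewrite -lead_coefE lead_coef_eq0.
by rewrite -size_poly_leq0 leqNgt szp.
Qed.

Lemma EC_inj p p' : EC p = EC p' -> p = p'.
Proof.
have ECN u : EC (- u) = - EC u by apply: (addrI (EC u)); rewrite -ECD !subrr EC0.
by move=> E; apply/eqP; rewrite -subr_eq0; apply/eqP/EC_eq0; rewrite ECD ECN E subrr.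
Qed.

(** The action of [H] is given on [S] only. If [f x^M = EC p] in [L], this polynomial represents the
    image of [f] under [h]: [c^i] comes from [x^i], and [c^-M] compensates for the denominator. *)
Definition act_poly h (c : k) M p : {poly R} :=
  \poly_(i < size p) (c ^+ i / c ^+ M *: actR h p`_i).

Lemma EC_act h c f M p : act h x = c *: x -> j f * X ^+ M = EC p ->
  j (act h f) * X ^+ M = EC (act_poly h c M p).
Proof.
move=> hx Ep; have c0 := weight_neq0 hS hx; have [n pn] := nilp_poly p.
have E : ECg p n = f * x ^+ (M + n).
  by apply: loc_inj; rewrite j_ECg // -Ep rmorphM rmorphXn exprD mulrA.
have hpn i : iter n.+1 delta (actR h p`_i) = 0.
  by apply: (scalerI (expf_neq0 n.+1 c0)); rewrite -actR_iter_delta // pn raddf0 scaler0.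
have := congr1 (fun g => j (act h g)) E.
rewrite !rmorphM /= !rmorphXn /= hx linearZ /= exprZn -scalerAr rmorph_sum rmorph_sum /=.
move=> E'; apply: (mulIr (unitrX n uX)); apply: (scalerI (expf_neq0 (M + n) c0)).
rewrite -mulrA -exprD -E' (@EC_wide (size p) (act_poly _ _ _ _)) ?size_poly //.
rewrite mulr_suml scaler_sumr; apply: eq_bigr => i _.
rewrite coef_poly ltn_ord !rmorphM /= !rmorphXn /= hx linearZ /= exprZn (act_gC _ _ hx).
rewrite linearZ /= j_gC // cauchonCZ -!scalerAl -!scalerAr !scalerA -!mulrA -!exprD [(i + n)%N]addnC.
congr (_ *: _); rewrite [(M + n)%N]addnC !exprD -!mulrA [c ^+ M * _]mulrCA.
by rewrite mulfV ?mulr1 // expf_neq0.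
Qed.

(** An explicit form of the ideal of [L] generated by [C P], for [P] an [H]-stable ideal
    ([ideal_generated_laurent]); membership can be tested on coefficients ([laurent_ECP]). *)
Definition laurent (P : set R) : set L :=
  [set y | exists (M : nat) (p : {poly R}), (forall i, P p`_i) /\ y * X ^+ M = EC p].

Lemma laurentXr P y n : laurent P y -> P 0 -> laurent P (y * X ^+ n).
Proof.
move=> [M [p [Pp Ep]]] P0; exists M, (p * 'X^n); split=> [i|].
  by rewrite coefMXn; case: ifP.
by rewrite EC_Xn -Ep -!mulrA -!exprD addnC.
Qed.

Lemma laurentXVr P y n : laurent P y -> laurent P (y / X ^+ n).
Proof.
move=> [M [p [Pp Ep]]]; exists (n + M)%N, p; split=> //.
by rewrite exprD mulrA mulrVK ?unitrX.
Qed.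

Lemma laurent_EC P p : (forall i, P p`_i) -> laurent P (EC p).
Proof. by move=> Pp; exists 0%N, p; rewrite mulr1. Qed.

Lemma laurent_ECP P p : P 0 -> laurent P (EC p) -> forall i, P p`_i.
Proof.
move=> P0 [M [u [Pu]]]; rewrite -EC_Xn => /EC_inj E i.
by have := Pu (i + M)%N; rewrite -E coefMXn ltnNge leq_addl addnK.
Qed.

Lemma laurent_C P r : P 0 -> laurent P (C r) <-> P r.
Proof.
move=> P0; rewrite -EC_C; split=> [/(laurent_ECP P0) /(_ 0%N)|Pr].
  by rewrite coefC.
by apply: laurent_EC => i; rewrite coefC; case: ifP.
Qed.

Lemma laurentD P y z : subspace P -> laurent P y -> laurent P z -> laurent P (y + z).
Proof.
move=> sP [M [p [Pp Ep]]] [M' [p' [Pp' Ep']]].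
exists (M + M')%N, (p * 'X^M' + p' * 'X^M); split=> [i|].
  by rewrite coefD !coefMXn; apply: subspaceD => //; case: ifP => // _; apply: subspace0.
by rewrite ECD !EC_Xn -Ep -Ep' mulrDl -!mulrA -!exprD [(M' + M)%N]addnC.
Qed.

Lemma laurent0 P : P 0 -> laurent P 0.
Proof. by move=> P0; exists 0%N, 0; split=> [i|]; rewrite ?coef0 // EC0 mul0r. Qed.

Lemma laurent_sum P I (s : seq I) (Q : pred I) F : subspace P ->
  (forall i, Q i -> laurent P (F i)) -> laurent P (\sum_(i <- s | Q i) F i).
Proof.
move=> sP PF; apply: big_ind => // [|y z]; last exact: laurentD.
exact: (laurent0 (subspace0 sP)).
Qed.

(* Inverting C(r) = sum_l q_l delta^l tau^-l (r) x^-l, by induction on the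
   nilpotency index of delta at r. *)
Lemma laurent_iota (P : set R) r : subspace P -> (forall r, P r -> P (delta r)) ->
  (forall r, P r -> P (tauV r)) -> P r -> laurent P (j (iota r)).
Proof.
move=> sP Pd Pt Pr; have [n nr] := cau_nilp hS r.
elim: n r Pr nr => [r _ /= ->|n IHn r Pr nr].
  by rewrite !raddf0; apply: (laurent0 (subspace0 sP)).
have -> : j (iota r) = C r + \sum_(l < n)
    j (iota (- qcoef q l.+1 *: dt l.+1 r)) / X ^+ l.+1.
  rewrite (cauchonC_sum nr) big_ord_recl /= qcoef0 scale1r invr1 mulr1 -addrA -[LHS]addr0.
  congr (_ + _); rewrite -big_split big1 // => l _ /=.
  by rewrite /bump add1n !linearZ /= -scalerAl scaleNr subrr.
have Piter l r' : P r' -> P (iter l delta r') by elim: l => //= l IHl /IHl; apply: Pd.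
have Ptiter l r' : P r' -> P (iter l tauV r') by elim: l => //= l IHl /IHl; apply: Pt.
apply: laurentD => //; first by apply/laurent_C => //; apply: subspace0.
apply: laurent_sum => // l _; apply/laurentXVr/IHn.
  by apply: subspaceZ => //; apply/Piter/Ptiter.
rewrite iter_deltaZ -iterD addnS -addSn addnC.
by rewrite (@iter_delta0 n.+1) ?scaler0 ?leq_addl //; apply: iter_delta_tauV0.
Qed.

Lemma laurentT y : laurent setT y.
Proof.
have sT : subspace [set: R] by split.
have [f [i ->]] := loc_frac hL y; apply: laurentXVr.
rewrite (co_sumE hO (leqnn (size (co f)))) rmorph_sum /=; apply: laurent_sum => // l _.
by rewrite rmorphM rmorphXn /=; apply: laurentXr => //; apply: laurent_iota.
Qed.

Section HIdeal.
Context (P : set R).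
Hypothesis iP : two_sided_ideal P.
Hypothesis hP : Hstable actR P.

Let P0 : P 0 := tsideal0 iP.
Let sP : subspace P := ideal_subspace iP.1.

Lemma Hstable_tau r : P r -> P (tau r). Proof. by rewrite -h0R; apply: hP. Qed.

Lemma Hstable_tauV r : P r -> P (tauV r). Proof. by rewrite tauVE; apply: hP. Qed.

Lemma laurentXl n y : laurent P y -> laurent P (X ^+ n * y).
Proof.
move=> [M [p [Pp Ep]]]; exists M, (iter n (map_poly tau) p * 'X^n); split=> [i|].
  rewrite coefMXn; case: ifP => // _; rewrite coef_iter_map.
  by elim: (n in iter n) => //= m IHm; apply: Hstable_tau.
by rewrite EC_Xn -mulrA Ep Xn_EC.
Qed.

Lemma laurentXVl n y : laurent P y -> laurent P (X ^- n * y).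
Proof.
move=> [M [p [Pp Ep]]]; exists (M + n)%N, (iter n (map_poly tauV) p).
have tauV0 : tauV 0 = 0 by rewrite tauVE raddf0.
have coefV i : (iter n (map_poly tauV) p)`_i = iter n tauV p`_i.
  by elim: n => //= n IHn; rewrite coef_map_id0 // IHn.
split=> [i|]; first by rewrite coefV; elim: (n) => //= m IHm; apply: Hstable_tauV.
apply: (mulrI (unitrX n uX)); rewrite Xn_EC exprD !mulrA mulrV ?unitrX // mul1r Ep.
congr (EC _ * _); apply/polyP => i; rewrite coef_iter_map coefV.
exact/esym/iter_tauVK.
Qed.

Lemma laurentCl r y : laurent P y -> laurent P (C r * y).
Proof.
move=> [M [p [Pp Ep]]]; exists M, (r%:P * p); split=> [i|].
  by rewrite coefCM; apply: tsidealMl.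
by rewrite -C_EC -Ep mulrA.
Qed.

Lemma laurentCr r y : laurent P y -> laurent P (y * C r).
Proof.
move=> [M [p [Pp Ep]]]; exists M.
pose r' := iter M tauV r; have Er : r = iter M tau r'.
  by rewrite iter_tauVK.
exists (\poly_(i < size p) (p`_i * iter i tau r')); split=> [i|].
  by rewrite coef_poly; case: ifP => // _; apply: tsidealMr.
rewrite Er -mulrA -Xn_cauchonC mulrA Ep.
rewrite (@EC_wide (size p) (\poly_(i < _) _)) ?size_poly // mulr_suml.
apply: eq_bigr => i _; rewrite coef_poly ltn_ord -mulrA Xn_cauchonC cauchonCM.
by rewrite mulrA.
Qed.

Lemma laurentMl y z : laurent P z -> laurent P (y * z).
Proof.
move=> Pz; have [M [u [_ Eu]]] := laurentT y.
rewrite -[y](mulrK (unitrX M uX)) Eu -mulrA mulr_suml; apply: laurent_sum => // i _.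
by rewrite -mulrA; apply/laurentCl/laurentXl/laurentXVl.
Qed.

Lemma laurentMr y z : laurent P z -> laurent P (z * y).
Proof.
move=> Pz; have [M [u [_ Eu]]] := laurentT y.
rewrite -[y](mulrK (unitrX M uX)) Eu mulrA; apply: laurentXVr.
rewrite mulr_sumr; apply: laurent_sum => // i _.
by rewrite mulrA; apply/laurentXr/P0/laurentCr.
Qed.

Lemma laurent_ideal : two_sided_ideal (laurent P).
Proof.
by split; split; [exact: laurent0|move=> a b; exact: laurentD|
  move=> r a; exact: laurentMl|exact: laurent0|move=> a b; exact: laurentD|
  move=> r a; exact: laurentMr].
Qed.

Lemma ideal_generated_laurent : ideal_generated (C @` P) = laurent P.
Proof.
apply/seteqP; split=> [y|y].
  apply: smallest_sub; first exact: laurent_ideal.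
  by move=> _ [r Pr <-]; apply/laurent_C.
move=> [M [p [Pp Ep]]] I [iI CI]; rewrite -[y](mulrK (unitrX M uX)) Ep.
apply: tsidealMr => //; apply: big_ind => // [||i _]; first exact: tsideal0.
  by move=> a b; apply: tsidealD.
by apply: tsidealMr => //; apply: CI; exists p`_i.
Qed.

Lemma Ctilde_laurent : Ctilde iota x tauV delta q j P = j @^-1` laurent P.
Proof. by rewrite /Ctilde ideal_generated_laurent. Qed.

(** After clearing denominators, [r x^(M+n)] equals [EC p x^n] in [S]; comparing top coefficients,
    [r] is the leading coefficient of [p], or 0 if [p = 0]. *)
Lemma laurent_iotaP r : laurent P (j (iota r)) -> P r.
Proof.
move=> [M [p [Pp Ep]]]; have [n pn] := nilp_poly p.
have E : ECg p n = iota r * x ^+ (M + n).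
  by apply: loc_inj; rewrite j_ECg // -Ep rmorphM rmorphXn exprD mulrA.
have coE : co (ECg p n) = r%:P * 'X^(M + n) by rewrite E (coMxn hO) (co_iota hO).
have [p0|/negPf p0] := eqVneq p 0.
  have := congr1 (fun u : {poly R} => u`_(M + n)) coE.
  rewrite /ECg p0 size_poly0 big_ord0 (co0 hO) coef0 coefMXn ltnn subnn coefC /=.
  by move <-.
have szm : size p = (size p).-1.+1 by rewrite prednK // lt0n size_poly_eq0 p0.
have := ECg_top n szm; rewrite coE coefMXn coefC.
have pm : p`_(size p).-1 != 0 by rewrite -lead_coefE lead_coef_eq0 p0.
case: ltnP => [_ /esym/eqP|]; first by rewrite (negPf pm).
case: eqP => [_ _ ->|_ _ /esym/eqP]; last by rewrite (negPf pm).
exact: Pp.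
Qed.

Lemma laurent_act h f : laurent P (j f) -> laurent P (j (act h f)).
Proof.
move=> [M [p [Pp Ep]]]; have [c hx] := cau_eigen hS h.
exists M, (act_poly h c M p); split; last exact: EC_act.
move=> i; rewrite coef_poly; case: ifP => // _; apply: subspaceZ => //; exact: hP.
Qed.

Lemma Ctilde_ideal : two_sided_ideal (j @^-1` laurent P).
Proof. exact/preimage_ideal/laurent_ideal. Qed.

Lemma laurent_not1 : ~ P 1 -> ~ laurent P 1.
Proof. by move=> nP1; rewrite -cauchonC1 => /laurent_C -/(_ P0). Qed.

Lemma Ctilde_notx : ~ P 1 -> ~ laurent P X.
Proof. by move=> /laurent_not1 nP1 /(laurentMl X^-1); rewrite mulVr. Qed.

(* The product of the lowest coefficients outside P is outside P. *)
Lemma laurent_cprime y z : (forall a b, P (a * b) -> P a \/ P b) ->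
  laurent P (y * z) -> laurent P y \/ laurent P z.
Proof.
move=> cP Pyz; apply: contrapT => /not_orP[ny nz].
have [M [u [_ Eu]]] := laurentT y; have [M' [v [_ Ev]]] := laurentT (X ^- M * z).
have nu : exists i, `[< ~ P u`_i >].
  apply: contrapT => nu; apply: ny; exists M, u; split=> // i.
  by apply: contrapT => nPi; apply: nu; exists i; apply/asboolP.
have nv : exists i, `[< ~ P v`_i >].
  apply: contrapT => nv; apply: nz.
  rewrite -[z](mulVKr (unitrX M uX)); apply: laurentMl; exists M', v; split=> // i.
  by apply: contrapT => nPi; apply: nv; exists i; apply/asboolP.
case: (ex_minnP nu) => a /asboolP nPa mina; case: (ex_minnP nv) => b /asboolP nPb minb.
have ltu i : (i < a)%N -> P u`_i.
  by move=> ia; apply: contrapT => /asboolP/mina; rewrite leqNgt ia.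
have ltv i : (i < b)%N -> P v`_i.
  by move=> ib; apply: contrapT => /asboolP/minb; rewrite leqNgt ib.
pose w := \sum_(i < size u) (u`_i)%:P * iter i (map_poly tau) v * 'X^i.
have Ew : y * z * X ^+ M' = EC w.
  have -> : y * z * X ^+ M' = EC u * EC v.
    by rewrite -Eu -Ev -!mulrA [X ^+ M * _]mulVKr ?unitrX.
  rewrite EC_sum {1}/EC mulr_suml; apply: eq_bigr => i _.
  by rewrite EC_Xn -C_EC -mulrA Xn_EC mulrA.
have Pw : P w`_(a + b) by apply: (laurent_ECP P0); rewrite -Ew; apply: laurentXr.
have ua : (a < size u)%N.
  by rewrite ltnNge; apply/negP => szu; apply: nPa; rewrite nth_default.
have iterP n r : P r -> P (iter n tau r) by elim: n => //= n IHn /IHn; apply: Hstable_tau.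
have iterVP n r : P (iter n tau r) -> P r.
  by elim: n => //= n IHn /Hstable_tauV; rewrite (ore_tauK hO).
move: Pw; rewrite coef_sum (bigD1 (Ordinal ua)) //= subspace_addr //; last first.
  apply: subspace_sum => // i; rewrite -val_eqE /= neq_ltn coefMXn coefCM coef_iter_map => ia.
  case: ltnP => // iab; case/orP: ia => ia; first by apply: tsidealMr => //; apply: ltu.
  apply: tsidealMl => //; apply/iterP/ltv.
  by rewrite ltn_subLR // ltn_add2r.
rewrite coefMXn ltnNge leq_addr /= addKn coefCM coef_iter_map.
by case/cP => // /iterVP.
Qed.

End HIdeal.

(** * The H-spectrum of S *)

Lemma specH_cprime P : specH actR P -> completely_prime P.
Proof.
move=> [[Ppr Pprime] hP]; apply: (cau_cprime hS); split=> // I J iI _ iJ _.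
exact: Pprime.
Qed.

(** * The chain condition for [H]-stable left ideals of [S] *)

Section LeadingCoefficients.
Implicit Type I : set S.

Definition lead_coefs I n : set R :=
  [set r | exists f, [/\ I f, (size (co f) <= n.+1)%N & (co f)`_n = r]].

Lemma lead_coefs_ideal I n : left_ideal I -> left_ideal (lead_coefs I n).
Proof.
move=> iI; have [I0 ID IM] := iI; split.
- by exists 0; rewrite (co0 hO) size_poly0 coef0.
- move=> _ _ [f [If szf <-]] [g [Ig szg <-]]; exists (f + g).
  rewrite (coD hO) coefD; split=> //; first exact: ID.
  by rewrite (leq_trans (size_polyD _ _)) // geq_max szf.
- move=> r _ [f [If szf <-]]; exists (iota r * f).
  rewrite (co_iotaM hO) coefCM; split=> //; first exact: IM.
  by apply/leq_sizeP => i ni; rewrite coefCM (leq_sizeP _ _ szf) ?mulr0.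
Qed.

(** Multiplication by [x] applies [tau] to the leading coefficient; acting with [h0^-1] beforehand
    undoes this, hence the need for [H]-stability. *)
Lemma lead_coefsS I n : left_ideal I -> Hstable act I ->
  lead_coefs I n `<=` lead_coefs I n.+1.
Proof.
move=> iI hI _ [f [If szf <-]]; have sI := ideal_subspace iI.
have [c hx] := cau_eigen hS h0^-1%g; have c0 := weight_neq0 hS hx.
pose g := act h0^-1%g f.
have szg : (size (co g) <= n.+1)%N.
  apply/leq_sizeP => i ni; rewrite (co_act hS _ _ hx) (leq_sizeP _ _ szf) //.
  by rewrite raddf0 scaler0.
exists (c ^- n *: (x * g)); split.
- by apply: subspaceZ => //; case: iI => _ _; apply; apply: hI.
- apply/leq_sizeP => i ni; rewrite (coZ hO).
  by rewrite (leq_sizeP _ _ (size_coxM hO szg)) ?scaler0.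
rewrite (coZ hO) (coxMS hO) [(co g)`_n.+1](leq_sizeP _ _ szg) // raddf0 addr0.
rewrite (co_act hS _ _ hx) -tauVE linearZ /= (ore_tauVK hO) scalerA.
by rewrite mulVf ?scale1r // expf_neq0.
Qed.

(* Hilbert's basis argument, for the H-stable chains only. *)
Lemma chain_stationary (I : nat -> set S) : (forall i, left_ideal (I i)) ->
  (forall i, Hstable act (I i)) -> (forall i, I i `<=` I i.+1) ->
  exists N, forall i, I i `<=` I N.
Proof.
move=> iI hI IS; have accR : acc (@left_ideal R) := (cau_noeth hS).1.
have Ile m i : (m <= i)%N -> I m `<=` I i.
  move/subnK <-; elim: (i - m)%N => // l IHl.
  by apply: subset_trans IHl _; apply: IS.
have lcI n m i : (m <= i)%N -> lead_coefs (I m) n `<=` lead_coefs (I i) n.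
  by move=> mi _ [f [If szf <-]]; exists f; split=> //; apply: Ile mi _ If.
have lcn n m i : (n <= m)%N -> lead_coefs (I i) n `<=` lead_coefs (I i) m.
  move/subnK <-; elim: (m - n)%N => // l IHl.
  by apply: subset_trans IHl _; apply: lead_coefsS.
(* The diagonal chain settles all degrees from [N0] on; the finitely many lower degrees are settled
   one by one. *)
have [N0 N0P] := accR (fun n => lead_coefs (I n) n)
  (fun n => lead_coefs_ideal n (iI n))
  (fun n => subset_trans (lcI n _ _ (leqnSn n)) (lcn _ _ _ (leqnSn n))).
have [N1 N1P] : exists N1, forall n i, (n < N0)%N -> lead_coefs (I i) n `<=` lead_coefs (I N1) n.
  elim: (N0) => [|m [N1 N1P]]; first by exists 0%N.
  have [N2 N2P] := accR (fun i => lead_coefs (I i) m)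
    (fun i => lead_coefs_ideal m (iI i)) (fun i => lcI m _ _ (leqnSn i)).
  exists (N1 + N2)%N => n i; rewrite ltnS leq_eqVlt => /orP[/eqP->|nm].
    apply: subset_trans (lcI m _ _ (leq_addr N2 i)) _.
    rewrite (N2P _ (leq_addl i N2)); apply: lcI; exact: leq_addl.
  by apply: subset_trans (N1P n i nm) _; apply: lcI; apply: leq_addr.
pose N := (N0 + N1)%N.
have lcN n i : lead_coefs (I i) n `<=` lead_coefs (I N) n.
  have [nN0|N0n] := ltnP n N0.
    by apply: subset_trans (N1P n i nN0) _; apply: lcI; apply: leq_addl.
  pose l := (n + i)%N.
  apply: subset_trans (lcI n i l (leq_addl _ _)) _.
  apply: subset_trans (lcn n l l (leq_addr _ _)) _.
  rewrite (N0P l (leq_trans N0n (leq_addr _ _))).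
  by apply: subset_trans (lcn _ _ _ N0n) _; apply: lcI; apply: leq_addr.
exists N => i; suff big l : (N <= l)%N -> I l `<=` I N.
  by apply: subset_trans (Ile _ _ (leq_addr N i)) _; apply: big; apply: leq_addl.
move=> Nl f If; have := leqnn (size (co f)); move: {2}(size _) => n.
elim: n f If => [|n IHn] f If szf.
  have -> : f = 0.
    by apply: (co_inj hO); rewrite (co0 hO); apply/eqP; rewrite -size_poly_leq0.
  by case: (iI N).
have /lcN [g [Ig szg gn]] : lead_coefs (I l) n (co f)`_n by exists f.
rewrite -[f](subrK g); have sN := ideal_subspace (iI N).
apply: subspaceD => //; apply: IHn.
  by apply: subspaceB; [exact: ideal_subspace|exact: If|exact: Ile Nl _ Ig].
apply/leq_sizeP => i'; rewrite (coB hO) coefB leq_eqVlt => /orP[/eqP<-|ni].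
  by rewrite gn subrr.
by rewrite (leq_sizeP _ _ szf) // (leq_sizeP _ _ szg) // subrr.
Qed.

End LeadingCoefficients.

(** * An [H]-stable prime of [S] and its contraction to [R] *)

Section PrimeOfS.
Context (Q : set S).
Hypothesis hQ : specH act Q.

Let iQ : two_sided_ideal Q. Proof. by case: hQ => -[[]]. Qed.
Let sQ : subspace Q := ideal_subspace iQ.1.
Let stQ : Hstable act Q. Proof. by case: hQ. Qed.

Let prQ I J : two_sided_ideal I -> two_sided_ideal J ->
  (forall a b, I a -> J b -> Q (a * b)) -> I `<=` Q \/ J `<=` Q.
Proof. by case: hQ => -[_ prQ] _; apply: prQ. Qed.

Let nQ1 : ~ Q 1.
Proof. by case: hQ => -[[_ ne] _] _; apply: proper_ideal1 ne; case: iQ. Qed.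

(** The left ideals of elements killed modulo [Q] by [x^i] become stationary, and the last one is
    two-sided by the Ore condition. Either it lies in [Q], or its right annihilator modulo [Q],
    which contains [x^N], does. *)
Lemma torsion_power : (forall f i, Q (f * x ^+ i) -> Q f) \/ exists N, Q (x ^+ N).
Proof.
pose I i := [set f | Q (f * x ^+ i)].
have iI i : left_ideal (I i).
  split; rewrite /I /=; first by rewrite mul0r; apply: tsideal0.
    by move=> a b; rewrite mulrDl; apply: tsidealD.
  by move=> r a; rewrite -mulrA; apply: tsidealMl.
have hI i : Hstable act (I i).
  move=> h f /= /(stQ h); have [c hx] := cau_eigen hS h.
  rewrite rmorphM rmorphXn /= hx exprZn -scalerAr; apply: (iffLR (subspaceZ_eq _ _ _)) => //.
  by rewrite expf_neq0 // (weight_neq0 hS hx).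
have IS i : I i `<=` I i.+1.
  by move=> f; rewrite /I /= exprSr mulrA; apply: tsidealMr.
have [N IN] := chain_stationary iI hI IS.
have iN : two_sided_ideal (I N).
  split; first exact: iI.
  have [I0 ID IM] := iI N; split=> // r a Qa.
  have [t [M Et]] := loc_frac hL (X ^- N * j r).
  apply: (IN M); rewrite /I /=.
  have -> : a * r * x ^+ M = a * x ^+ N * t.
    apply: loc_inj; rewrite !rmorphM !rmorphXn /= -!mulrA; congr (_ * _).
    have -> : j r = X ^+ N * (j t / X ^+ M) by rewrite -Et mulVKr ?unitrX.
    by rewrite -mulrA mulrVK ?unitrX.
  exact: tsidealMr.
pose J := [set b | forall a, I N a -> Q (a * b)].
have iJ : two_sided_ideal J.
  by apply: (right_annihilator_ideal iQ) => r a; apply: tsidealMr.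
case: (prQ iN iJ) => [a b Ia Jb|INQ|JQ]; first exact: Jb.
  by left=> f i Qf; apply: INQ; apply: IN i _ Qf.
by right; exists N; apply: JQ => a.
Qed.

Local Notation Q0 := (iota @^-1` Q).

Lemma contraction_ideal : two_sided_ideal Q0.
Proof. exact: preimage_ideal. Qed.

Let iQ0 := contraction_ideal.

Let sQ0 : subspace Q0 := ideal_subspace iQ0.1.

Lemma contraction_Hstable : Hstable actR Q0.
Proof. by move=> h r Qr; rewrite /preimage /= -(cau_Rstable hS); apply: stQ. Qed.

Let hQ0 := contraction_Hstable.

Lemma contraction_delta r : Q0 r -> Q0 (delta r).
Proof.
move=> Qr; have -> : Q0 (delta r) = Q (x * iota r - iota (tau r) * x).
  by rewrite (ore_comm hO) addrAC subrr add0r.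
apply: subspaceB => //; first exact: tsidealMl.
by apply: tsidealMr => //; apply: Hstable_tau hQ0 _ Qr.
Qed.

Definition extension (I : set R) : set S := [set f | forall i, I (co f)`_i].

Section Extension.
Context (I : set R).
Hypotheses (iI : two_sided_ideal I) (hI : Hstable actR I).
Hypothesis dI : forall r, I r -> I (delta r).

Let sI : subspace I := ideal_subspace iI.1.

Lemma extension_subspace : subspace (extension I).
Proof.
split=> [i|a f g If Ig i]; first by rewrite (co0 hO) coef0; apply: subspace0.
by rewrite (coD hO) coefD (coZ hO); apply: subspaceD => //; apply: subspaceZ.
Qed.

Lemma extension_xn n f : extension I f -> extension I (x ^+ n * f).
Proof.
move=> If; elim: n => [|n IHn]; first by rewrite mul1r.
rewrite exprS -mulrA => -[|i]; first by rewrite (coxM0 hO); apply: dI.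
by rewrite (coxMS hO); apply: subspaceD => //; [apply: Hstable_tau|apply: dI].
Qed.

Lemma extension_ideal : two_sided_ideal (extension I).
Proof.
have [E0 _] := extension_subspace.
have ED := subspaceD extension_subspace.
split; split=> // g f If; last first.
  rewrite (co_sumE hO (leqnn (size (co f)))) mulr_suml.
  apply: subspace_sum => [|i _ n]; first exact: extension_subspace.
  by rewrite -mulrA (co_iotaM hO) coefCM; apply: tsidealMr.
rewrite (co_sumE hO (leqnn (size (co g)))) mulr_suml.
apply: subspace_sum => [|i _ n]; first exact: extension_subspace.
rewrite -mulrA (co_iotaM hO) coefCM; apply: tsidealMl => //.
exact: extension_xn.
Qed.

End Extension.

(** Stability under [delta] makes [extension I] and [extension J] ideals of [S], to which primeness
    of [Q] applies. *)
Lemma contraction_delta_prime I J :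
  two_sided_ideal I -> Hstable actR I -> (forall r, I r -> I (delta r)) ->
  two_sided_ideal J -> Hstable actR J -> (forall r, J r -> J (delta r)) ->
  (forall a b, I a -> J b -> Q0 (a * b)) -> I `<=` Q0 \/ J `<=` Q0.
Proof.
move=> iI hI dI iJ hJ dJ IJ.
have inQ0 (K : set R) : two_sided_ideal K -> extension K `<=` Q -> K `<=` Q0.
  move=> iK KQ r Kr; apply: KQ => i; rewrite (co_iota hO) coefC.
  by case: ifP => // _; apply: (tsideal0 iK).
case: (prQ (extension_ideal iI hI dI) (extension_ideal iJ hJ dJ)); last first.
- by right; apply: inQ0.
- by left; apply: inQ0.
move=> f g If Jg; rewrite (co_sumE hO (leqnn (size (co f)))) mulr_suml.
apply: subspace_sum => // i _; rewrite -mulrA.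
have Jxg := extension_xn iJ hJ dJ i Jg.
rewrite (co_sumE hO (leqnn (size (co (x ^+ i * g))))) mulr_sumr.
apply: subspace_sum => // l _; rewrite mulrA -rmorphM.
by apply: tsidealMr => //; apply: IJ.
Qed.

(* A maximal annihilator A modulo Q0 is H-prime, and its largest delta-stable
   part, the contraction of laurent A, is completely prime; it is Q0. *)
Lemma contraction_cprime : forall a b, Q0 (a * b) -> Q0 a \/ Q0 b.
Proof.
pose ann (K : set R) : set R := [set r | forall a, K a -> Q0 (r * a)].
have annl K : left_ideal (ann K).
  split; rewrite /ann /=.
  - by move=> a _; rewrite mul0r; exact: (tsideal0 iQ0).
  - by move=> r r' Kr Kr' a Ka; rewrite mulrDl; apply: (tsidealD iQ0) => //; [apply: Kr|apply: Kr'].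
  - by move=> s r Kr a Ka; rewrite -mulrA; apply: (tsidealMl iQ0); apply: Kr.
have annr K : two_sided_ideal K -> two_sided_ideal (ann K).
  move=> iK; have [A0 AD _] := annl K; split=> //; split=> // s r Kr a Ka.
  by rewrite -mulrA; apply: Kr; apply: tsidealMl.
have annh K : Hstable actR K -> Hstable actR (ann K).
  move=> hK h r Kr a Ka; rewrite -[a](actRK hS h) -rmorphM.
  by apply: hQ0; apply: Kr; apply: hK.
pose F : set (set R) := [set A | exists K : set R,
  [/\ two_sided_ideal K, Hstable actR K, ~ K `<=` Q0 & A = ann K]].
have [||_ [K [iK hK nKQ ->]] maxA] :=
    @acc_maximal _ (@left_ideal R) F (cau_noeth hS).1.
- by move=> _ [K [_ _ _ ->]].
- exists (ann setT), setT; split=> //.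
  by move=> TQ; apply: nQ1; rewrite -(rmorph1 iota); apply: TQ.
have iA := annr K iK; have hA := annh K hK.
have nA1 : ~ ann K 1.
  by move=> A1; apply: nKQ => a Ka; rewrite -[a]mul1r; apply: A1.
have [_ cA] : completely_prime (ann K).
  apply: (cau_cprime hS); split=> //.
    by split=> // A_T; apply: nA1; rewrite A_T.
  move=> I J iI hI iJ hJ IJ.
  have [|nJA] := EM (J `<=` ann K); [by right|left].
  (* The part of [K] killed by [I] modulo [Q0]. It contains [J K], so it is not inside [Q0], and
     maximality gives it the same annihilator as [K]; that annihilator contains [I]. *)
  pose K' : set R := [set a | K a /\ forall b, I b -> Q0 (b * a)].
  have iK' : two_sided_ideal K'.
    have [[Z0 ZD Zl] [_ _ Zr]] : two_sided_ideal [set a | forall b, I b -> Q0 (b * a)].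
      by apply: (right_annihilator_ideal iQ0) => r b; apply: tsidealMr.
    have [[K0 KD Kl] [_ _ Kr]] := iK.
    split; split=> [|a b [? ?] [? ?]|r a [? ?]]; split=> //;
      by [apply: KD|apply: ZD|apply: Kl|apply: Zl|apply: Kr|apply: Zr].
  have hK' : Hstable actR K'.
    move=> h a [Ka Qa]; split=> [|b Ib]; first exact: hK.
    by rewrite -[b](actRK hS h) -rmorphM; apply: hQ0; apply: Qa; apply: hI.
  have FK' : F (ann K').
    exists K'; split=> // K'Q; apply: nJA => b Jb a Ka; apply: K'Q; split.
      exact: tsidealMl.
    by move=> c Ic; rewrite mulrA; apply: IJ.
  have <- : ann K' = ann K by apply: maxA FK' _ => r Ar a [Ka _]; apply: Ar.
  by move=> b Ib a [_]; apply.
pose A' := [set r | laurent (ann K) (j (iota r))].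
have A'A : A' `<=` ann K by move=> r; apply: laurent_iotaP.
have iA' : two_sided_ideal A'.
  exact: (preimage_ideal iota (preimage_ideal j (laurent_ideal iA hA))).
have hA' : Hstable actR A'.
  by move=> h r Ar; rewrite /A' /= -(cau_Rstable hS); apply: laurent_act.
have dA' r : A' r -> A' (delta r).
  move=> Ar; have lA := laurent_ideal iA hA.
  have -> : A' (delta r) = laurent (ann K) (X * j (iota r) - j (iota (tau r)) * X).
    by rewrite X_iota addrAC subrr add0r.
  apply: (subspaceB (ideal_subspace lA.1)); first exact: tsidealMl.
  by apply: tsidealMr => //; apply: Hstable_tau hA' _ Ar.
have Q0A' : Q0 `<=` A'.
  have QA : Q0 `<=` ann K by move=> r Qr a _; apply: (tsidealMr iQ0).
  move=> r Qr.
  have [M [p [Qp Ep]]] := laurent_iota sQ0 contraction_delta (Hstable_tauV hQ0) Qr.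
  by exists M, p; split=> // i; apply: QA.
suff A'Q0 : A' `<=` Q0.
  move=> a b /Q0A'; rewrite /A' /= !rmorphM => /(laurent_cprime iA hA)-/(_ cA).
  by case=> [Aa|Ab]; [left|right]; apply: A'Q0.
(* The right annihilator of [A'] modulo [Q0] is [delta]-stable and contains [K], so it is not inside
   [Q0]; [contraction_delta_prime] then leaves only [A'] inside [Q0]. *)
pose K' : set R := [set a | forall b, A' b -> Q0 (b * a)].
have KK' : K `<=` K' by move=> a Ka b /A'A; apply.
have iK' : two_sided_ideal K'.
  by apply: (right_annihilator_ideal iQ0) => r b; apply: tsidealMr.
have hK' : Hstable actR K'.
  move=> h a Qa b Ib.
  by rewrite -[b](actRK hS h) -rmorphM; apply: hQ0; apply: Qa; apply: hA'.
have dK' a : K' a -> K' (delta a).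
  move=> Ka b Ab; rewrite -(ore_tauVK hO b).
  have Ab' := Hstable_tauV hA' Ab.
  have := contraction_delta (Ka _ Ab'); rewrite (ore_deriv hO).
  by rewrite subspace_addr //; apply: Ka; apply: dA'.
have [||K'Q] := contraction_delta_prime iA' hA' dA' iK' hK' dK' => //.
  by move=> a b Aa; apply.
by case: nKQ; apply: subset_trans K'Q.
Qed.

(** For a [tau]-eigenvector, [delta r = x r - c r x], and [delta r] is an eigenvector for [c / q];
    hence [delta^M r] is a combination of the [x^i r x^(M-i)]. *)
Lemma iter_delta_span (V : set S) M r c : subspace V -> tau r = c *: r ->
  (forall i, (i <= M)%N -> V (x ^+ i * iota r * x ^+ (M - i))) ->
  V (iota (iter M delta r)).
Proof.
move=> sV; elim: M r c => [|M IHM] r c tr Vr.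
  by have := Vr 0%N isT; rewrite mul1r mulr1.
rewrite iterSr; apply: (IHM _ (c / q)) => [|i iM].
  have := cau_comm hS r; rewrite tr linearZ /= => E.
  by rewrite mulrC -scalerA E scalerA mulVf ?scale1r // (cau_q0 hS).
have -> : x ^+ i * iota (delta r) * x ^+ (M - i) =
    x ^+ i.+1 * iota r * x ^+ (M.+1 - i.+1) - c *: (x ^+ i * iota r * x ^+ (M.+1 - i)).
  rewrite subSS (subSn iM) exprSr exprS -(mulrA _ x (iota r)) (ore_comm hO) tr.
  rewrite mulrDr mulrDl linearZ /= -scalerAl -scalerAr -scalerAl !mulrA.
  by rewrite addrAC subrr add0r.
apply: subspaceB => //; first exact: Vr.
by apply: subspaceZ => //; apply: Vr; rewrite leqW.
Qed.

(** In [x^i r x^(N+N-i)] one of the two exponents is at least [N]. *)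
Lemma power_iter_delta N r : Q (x ^+ N) -> Q0 (iter (N + N) delta r).
Proof.
move=> QN; pose Pr := [set r | Q0 (iter (N + N) delta r)].
have sT : subspace [set: R] by split.
suff: Pr r by [].
apply: (@eigen_sum_ind _ _ tau _ setT Pr _ _ _ _ _ _ r) => // [|r' _|||c r' _ tr' _].
- exact: linearP.
- exact: eigen_sum_tau.
- by rewrite /Pr /= (@iter_delta0 0%N) //; apply: tsideal0 iQ0.
- by move=> f g Qf Qg; rewrite /Pr /= iter_deltaD; apply: (tsidealD iQ0).
apply: iter_delta_span tr' _ => // i iN.
have [Ni|iN'] := leqP N i.
  rewrite -(subnKC Ni) exprD -!mulrA; exact: tsidealMr.
have Ni : (N <= N + N - i)%N by rewrite leq_subRL ?leq_add2r ?(ltnW iN').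
by rewrite -(subnK Ni) exprD mulrA; apply: tsidealMl.
Qed.

(* If delta^K maps R into Q0 with K minimal, K > 1, then modulo Q0 the q-Leibniz
   rule gives delta^K (a b) = [K]_q tau (delta^(K-1) a) delta b when delta^2 b = 0. *)
Lemma contraction_delta_nilp K : (forall r, Q0 (iter K delta r)) -> forall r, Q0 (delta r).
Proof.
move=> QK; have exK : exists K, `[< forall r, Q0 (iter K delta r) >].
  by exists K; apply/asboolP.
case: (ex_minnP exK) => {QK exK}K /asboolP QK minK.
case: K QK minK => [|[|n]] QK minK.
- by case: nQ1; rewrite -(rmorph1 iota); apply: QK.
- exact: QK.
have Qle l r : (n.+2 <= l)%N -> Q0 (iter l delta r).
  by move/subnK <-; rewrite iterD; elim: (l - _)%N => [|i]; [apply: QK|apply: contraction_delta].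
suff /asboolP/minK : forall r, Q0 (iter n.+1 delta r) by rewrite ltnn.
move=> r; pose b := iter n delta r.
have leibniz l a : Q0 (iter l.+1 delta (a * b) - (iter l.+1 delta a * b +
    (\sum_(i < l.+1) q ^+ i) *: (tau (iter l delta a) * delta b))).
  elim: l => [|l IHl].
    rewrite big_ord1 expr0 scale1r /= (ore_deriv hO) [X in _ - X]addrC subrr.
    exact: (tsideal0 iQ0).
  have dbb : Q0 (delta (delta b)) by apply: QK.
  have := contraction_delta IHl.
  rewrite raddfB raddfD /= linearZ /= !(ore_deriv hO) (cau_comm hS) -scalerAl.
  rewrite scalerDr scalerA => E.
  have := subspaceD sQ0 E (subspaceZ sQ0 (\sum_(i < l.+1) q ^+ i)
    (tsidealMl iQ0 (tau (tau (iter l delta a))) dbb)).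
  have -> : \sum_(i < l.+2) q ^+ i = 1 + (\sum_(i < l.+1) q ^+ i) * q.
    rewrite big_ord_recl expr0 mulr_suml; congr (_ + _).
    by apply: eq_bigr => i _; rewrite lift0 exprSr.
  congr Q0; rewrite scalerDl scale1r.
  rewrite [X in _ - (_ + X)]addrC addrA opprD addrA subrK; congr (_ - _).
  by rewrite [X in X + _]addrC -addrA.
(* With [a = r], the factors [delta^(n+1) a] and [delta b] are both [delta^(n+1) r], so complete
   primeness puts this element into [Q0]. *)
have := subspaceB sQ0 (QK (r * b)) (leibniz n.+1 r).
rewrite opprB addrC subrK subspace_addl; last by apply: (tsidealMr iQ0); apply: QK.
  have sum0 : \sum_(i < n.+2) q ^+ i != 0.
    have := cau_q hS (ltn0Sn n.+1); rewrite -subr_eq0 subrX1 mulf_eq0.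
    by case/norP.
  rewrite subspaceZ_eq // => /contraction_cprime[/(Hstable_tauV hQ0)|//].
  by rewrite (ore_tauK hO).
exact: sQ0.
Qed.

(** Since [delta] vanishes modulo [Q], [x r] and [tau(r) x] agree there. So the elements killed by
    [x^(n+1)] modulo [Q] form a two-sided ideal, and primeness lowers the exponent. *)
Lemma power_x N : Q (x ^+ N) -> Q x.
Proof.
move=> QN; have dQ := contraction_delta_nilp (fun r => power_iter_delta r QN).
have swap r f : Q (x * iota r * f - iota (tau r) * x * f).
  rewrite -mulrBl (ore_comm hO) addrAC subrr add0r.
  by apply: tsidealMr => //; apply: dQ.
have swapn n r : Q (x ^+ n * iota (iter n tauV r) - iota r * x ^+ n).
  elim: n r => [|n IHn] r; first by rewrite mul1r mulr1 subrr; apply: subspace0.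
  have := IHn (tauV r); rewrite -iterSr => /(tsidealMl iQ x).
  have := swap (tauV r) (x ^+ n); rewrite (ore_tauVK hO) => Q1 /(subspaceD sQ Q1).
  by rewrite mulrBr !mulrA -exprS -!mulrA -exprS addrC addrA subrK.
elim: N QN => [/nQ1//|[|n] IHn QN]; first by rewrite -[x]expr1.
pose V := [set f | Q (f * x ^+ n.+1)].
pose J := [set f | forall a, V a -> Q (a * f)].
have iV : two_sided_ideal V.
  have VD a b : V a -> V b -> V (a + b).
    by move=> Va Vb; rewrite /V /= mulrDl; apply: tsidealD.
  have V0 : V 0 by rewrite /V /= mul0r; apply: subspace0.
  have Vx a i : V a -> V (a * x ^+ i).
    by move=> Va; rewrite /V /= -mulrA -exprD addnC exprD mulrA; apply: tsidealMr.
  have Vi a r : V a -> V (a * iota r).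
    move=> Va; rewrite /V /= -mulrA.
    have := tsidealMl iQ a (swapn n.+1 r).
    rewrite mulrBr => /(subspaceB sQ (tsidealMr iQ (iota (iter n.+1 tauV r)) Va)).
    by rewrite -mulrA opprB addrC subrK.
  split; split=> // r a Va.
    by rewrite /V /= -mulrA; apply: tsidealMl.
  rewrite (co_sumE hO (leqnn (size (co r)))) mulr_sumr.
  by apply: big_ind => // i _; rewrite mulrA; apply/Vx/Vi.
have iJ : two_sided_ideal J.
  by apply: (right_annihilator_ideal iQ) => r a; apply: tsidealMr.
case: (prQ iV iJ) => [a b Va Jb|VQ|JQ]; first exact: Jb.
  by apply: VQ; rewrite /V /= -exprS.
by apply: IHn; apply: JQ.
Qed.

(** * Primes without [x], recovered from the localization *)

Hypothesis nQx : ~ Q x.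

Lemma torsion_free f i : Q (f * x ^+ i) -> Q f.
Proof. by case: torsion_power => [tf|[N /power_x]//]; apply: tf. Qed.

Definition fractions : set L := [set y | exists i f, Q f /\ y * X ^+ i = j f].

Local Notation QL := fractions.

Lemma fractions_j f : QL (j f) -> Q f.
Proof.
case=> i [g [Qg Eg]]; apply: (@torsion_free _ i).
by have -> : f * x ^+ i = g by apply: loc_inj; rewrite rmorphM rmorphXn.
Qed.

Lemma j_fractions f : Q f -> QL (j f).
Proof. by move=> Qf; exists 0%N, f; rewrite mulr1. Qed.

Lemma fractionsMr y z : QL y -> QL (y * z).
Proof.
move=> [i [f [Qf Ef]]]; have [t [m Et]] := loc_frac hL (X ^- i * z).
exists m, (f * t); split; first exact: tsidealMr.
by rewrite rmorphM /= -Ef -[z](mulVKr (unitrX i uX)) Et -!mulrA mulVr ?unitrX // mulr1.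
Qed.

Lemma fractionsMl f y : QL y -> QL (j f * y).
Proof.
move=> [i [g [Qg Eg]]]; exists i, (f * g); split; first exact: tsidealMl.
by rewrite rmorphM /= -Eg mulrA.
Qed.

Lemma fractions_subspace : subspace QL.
Proof.
split; first by rewrite -(raddf0 j); apply: (j_fractions (subspace0 sQ)).
move=> a y z [i [f [Qf Ef]]] [i' [g [Qg Eg]]].
exists (i + i')%N, (a *: (f * x ^+ i') + g * x ^+ i); split.
  by apply: sQ.2; apply: tsidealMr.
rewrite raddfD /= linearZ /= !rmorphM !rmorphXn /= -Ef -Eg mulrDl -scalerAl.
by rewrite -!mulrA -!exprD [(i' + i)%N]addnC.
Qed.

Definition contracted : set R := [set r | QL (C r)].

Local Notation P := contracted.

Lemma contractedP n r : iter n.+1 delta r = 0 -> (P r <-> Q (gC r n)).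
Proof.
move=> nr; split=> [Pr|Qg].
  by apply: fractions_j; rewrite j_gC //; apply: fractionsMr.
rewrite /contracted /= -[C r](mulrK (unitrX n uX)) -j_gC //.
exact/fractionsMr/j_fractions.
Qed.

Lemma contracted_Hstable : Hstable actR P.
Proof.
move=> h r Pr; have [n nr] := cau_nilp hS r.
have nr1 : iter n.+1 delta r = 0 by apply: iter_delta0 nr _.
have [c hx] := cau_eigen hS h; have c0 := weight_neq0 hS hx.
apply/(@contractedP n).
  by apply: (scalerI (expf_neq0 n.+1 c0)); rewrite -actR_iter_delta // nr1 raddf0 scaler0.
have /(stQ h) := (contractedP nr1).1 Pr; rewrite (act_gC _ _ hx).
by rewrite subspaceZ_eq // expf_neq0.
Qed.

Lemma contracted_ideal : two_sided_ideal P.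
Proof.
have sQL := fractions_subspace.
have P0 : P 0 by rewrite /contracted /= cauchonC0; apply: subspace0.
have PD a b : P a -> P b -> P (a + b).
  by move=> Pa Pb; rewrite /contracted /= cauchonCD; apply: subspaceD.
split; split=> // r a Pa; rewrite /contracted /= cauchonCM.
  have [n nr] := cau_nilp hS r; have nr1 : iter n.+1 delta r = 0 by apply: iter_delta0 nr _.
  rewrite -[C r](mulrK (unitrX n uX)) -j_gC // -mulrA; apply: fractionsMl.
  have -> : X ^- n * C a = C (iter n tauV a) / X ^+ n.
    apply: (mulrI (unitrX n uX)); rewrite mulrA mulrV ?unitrX // mul1r mulrA Xn_cauchonC.
    by rewrite mulrK ?unitrX // iter_tauVK.
  apply: fractionsMr; elim: n {nr nr1} => //= n IHn.
  by rewrite tauVE; apply: contracted_Hstable.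
exact: fractionsMr.
Qed.

Lemma laurent_fractions : laurent P `<=` QL.
Proof.
move=> y [M [p [Pp Ep]]]; rewrite -[y](mulrK (unitrX M uX)) Ep; apply: fractionsMr.
apply: subspace_sum => [|i _]; first exact: fractions_subspace.
by apply: fractionsMr; apply: Pp.
Qed.

(* An h0-eigenvector of Q splits in L into eigenvectors C(p_i) x^i of the
   conjugation by x, with pairwise distinct eigenvalues. *)
Lemma fractions_laurent f : Q f -> laurent P (j f).
Proof.
have iP := contracted_ideal; have sP := ideal_subspace iP.1.
have lQ := linearP (act h0).
apply: (eigen_sum_ind lQ (Pr := fun f => laurent P (j f)) sQ (stQ h0)) => [g _||g g'|c g Qg hg g0].
- exact: (eigen_sum_act hS htau h0R h0x).
- by rewrite raddf0; apply/laurent0/(tsideal0 iP).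
- by rewrite raddfD; apply: laurentD.
have c0 : c != 0.
  apply/eqP => c0; move/eqP: g0; apply; apply: (act_inj hS (h := h0)).
  by rewrite hg c0 scale0r raddf0.
have [M [p [_ Ep]]] := laurentT (j g).
have lam0 := weight_neq0 hS h0x.
pose w i := c * lam ^+ M / lam ^+ i.
have tp i : tau p`_i = w i *: p`_i.
  have [szi|szi] := leqP (size p) i; first by rewrite nth_default // raddf0 scaler0.
  have := EC_act h0x Ep; rewrite hg linearZ /= -scalerAl Ep.
  have -> : c *: EC p = EC ((c%:A)%:P * p).
    rewrite -C_EC cauchonCZ cauchonC1 -scalerAl mul1r //.
  move/EC_inj => /(congr1 (fun u : {poly R} => u`_i)).
  rewrite coefCM coef_poly szi h0R mulr_algl => E.
  have lamiM : lam ^+ i / lam ^+ M != 0 by rewrite mulf_neq0 ?invr_eq0 ?expf_neq0.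
  apply: (scalerI lamiM); rewrite -E scalerA; congr (_ *: _); rewrite /w.
  by field; rewrite !expf_neq0.
exists M, p; split=> // i.
have [szi|szi] := leqP (size p) i; first by rewrite nth_default //; apply: (tsideal0 iP).
suff QLi : QL (C p`_i * X ^+ i).
  by rewrite /contracted /= -[C _](mulrK (unitrX i uX)); apply: fractionsMr.
pose T y := X * y * X^-1.
have lT : linear T.
  by move=> a y z; rewrite /T mulrDr mulrDl -scalerAr -scalerAl.
apply: (@eigen_components _ _ T lT QL _ (seq.iota 0 (size p)) w (fun i => C p`_i * X ^+ i)).
- exact: fractions_subspace.
- by move=> y QLy; apply/fractionsMr/fractionsMl.
- exact: iota_uniq.
- move=> i1 i2 _ _; rewrite /w => /mulfI E; apply/eqP; apply: contraT.
  have {}E : lam ^+ i1 = lam ^+ i2.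
    by apply: invr_inj; apply: E; rewrite mulf_neq0 ?expf_neq0.
  rewrite neq_ltn => /orP[] /(weight_exp_neq hS h0x lam_nru); rewrite E eqxx //.
- move=> l _; rewrite /T mulrA X_cauchonC tp cauchonCZ -!scalerAl -!mulrA; congr (_ *: (_ * _)).
  by rewrite mulrA -exprS exprSr mulrK.
- have -> : \sum_(l <- seq.iota 0 (size p)) C p`_l * X ^+ l = EC p.
    by rewrite /EC -(big_mkord xpredT (fun l => C p`_l * X ^+ l)) /index_iota subn0.
  by rewrite -Ep; apply/fractionsMr/j_fractions.
by rewrite mem_iota.
Qed.

(** H-primeness suffices, by the hypothesis on [R]. For [H]-stable ideals [I] and [J], primeness of
    [Q] is applied to the preimages in [S] of [laurent I] and [laurent J]. *)
Lemma contracted_spec : specH actR P.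
Proof.
have iP := contracted_ideal; have hP := contracted_Hstable.
split=> //; apply: completely_prime_prime; apply: (cau_cprime hS).
have nP1 : ~ P 1.
  by rewrite /contracted /= cauchonC1 -(rmorph1 j) => /fractions_j.
split=> //; first by split=> // P_T; apply: nP1; rewrite P_T.
move=> I J iI hI iJ hJ IJ.
have inP (K : set R) : two_sided_ideal K -> j @^-1` laurent K `<=` Q -> K `<=` P.
  move=> iK KQ r Kr; have [n nr] := cau_nilp hS r.
  have nr1 : iter n.+1 delta r = 0 by apply: iter_delta0 nr _.
  apply/(contractedP nr1)/KQ; rewrite /preimage /= j_gC //.
  by apply: laurentXr; [apply/laurent_C|]; rewrite //; apply: (tsideal0 iK).
case: (prQ (Ctilde_ideal iI hI) (Ctilde_ideal iJ hJ)) => [f g If Jg|IQ|JQ]; last 2 first.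
- by left; apply: inP.
- by right; apply: inP.
apply: fractions_j; rewrite rmorphM /=; apply: laurent_fractions.
have sP := ideal_subspace iP.1.
case: If => M [u [Iu Eu]]; rewrite -[j f](mulrK (unitrX M uX)) Eu -mulrA mulr_suml.
apply: laurent_sum => // i _; rewrite -mulrA.
have [M' [v [Jv Ev]]] := laurentXl iJ hJ i (laurentXVl hJ M Jg).
exists M', ((u`_i)%:P * v); split=> [l|]; first by rewrite coefCM; apply: IJ.
by rewrite -C_EC -Ev !mulrA.
Qed.

Lemma contracted_Ctilde : Q = j @^-1` laurent P.
Proof.
apply/seteqP; split=> f; first exact: fractions_laurent.
by move/laurent_fractions/fractions_j.
Qed.

End PrimeOfS.

(** * The primes without [x], the primes with [x], and inclusions between them *)

Lemma specH_ideal P : specH actR P -> two_sided_ideal P.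
Proof. by case=> -[[]]. Qed.

Lemma specH_Hstable P : specH actR P -> Hstable actR P.
Proof. by case. Qed.

Lemma specH_not1 P : specH actR P -> ~ P 1.
Proof. by case=> -[[[iP _] ne] _] _; apply: proper_ideal1 ne. Qed.

Lemma CtildeE P : specH actR P -> Ctilde iota x tauV delta q j P = j @^-1` laurent P.
Proof.
by move=> hP; apply: Ctilde_laurent; [apply: specH_ideal|apply: specH_Hstable].
Qed.

Lemma Ctilde_spec P : specH actR P -> specH act (Ctilde iota x tauV delta q j P).
Proof.
move=> sP; have iP := specH_ideal sP; have hP := specH_Hstable sP; have nP1 := specH_not1 sP.
have [_ cP] := specH_cprime sP; rewrite CtildeE //; split.
  apply: completely_prime_prime; split.
    split=> [|LT]; first exact: Ctilde_ideal.
    apply: (laurent_not1 iP nP1); rewrite -(rmorph1 j).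
    by have : [set: S] 1 by []; rewrite -LT.
  by move=> f g; rewrite /preimage /= rmorphM; apply: laurent_cprime.
by move=> h f; apply: laurent_act.
Qed.

Lemma Ctilde_x P : specH actR P -> ~ Ctilde iota x tauV delta q j P x.
Proof.
move=> sP; rewrite CtildeE //; apply: Ctilde_notx; [exact: specH_ideal|exact: specH_Hstable|].
exact: specH_not1.
Qed.

Lemma Ctilde_subset P P' : specH actR P -> specH actR P' ->
  (Ctilde iota x tauV delta q j P `<=` Ctilde iota x tauV delta q j P' <-> P `<=` P').
Proof.
move=> sP sP'; rewrite !CtildeE //; split=> PP'; last first.
  by move=> f [M [p [Pp Ep]]]; exists M, p; split=> // i; apply: PP'.
have P0 := tsideal0 (specH_ideal sP); have iP' := specH_ideal sP'.
move=> r Pr; have [n nr] := cau_nilp hS r.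
have nr1 : iter n.+1 delta r = 0 by apply: iter_delta0 nr _.
apply/(laurent_C _ (tsideal0 iP')); rewrite -[C r](mulrK (unitrX n uX)) -j_gC //.
by apply: laurentXVr; apply: PP'; rewrite /preimage /= j_gC //; apply: laurentXr => //; apply/laurent_C.
Qed.

Lemma Ctilde_onto Q : specH act Q -> ~ Q x ->
  exists2 P, specH actR P & Q = Ctilde iota x tauV delta q j P.
Proof.
move=> hQ nQx; exists (contracted Q); first exact: contracted_spec.
by rewrite CtildeE; [exact: contracted_Ctilde|exact: contracted_spec].
Qed.

Lemma contraction_spec Q : specH act Q -> specH actR (iota @^-1` Q).
Proof.
move=> hQ; have iQ := contraction_ideal hQ; have [[[_ neQ] _] _] := hQ.
split; last exact: contraction_Hstable.
apply: completely_prime_prime; split; last exact: contraction_cprime.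
split=> // QT; have : (iota @^-1` Q) 1 by rewrite QT.
rewrite /preimage /= rmorph1; case: hQ => -[[[iQl _] _] _] _.
exact: proper_ideal1 iQl neQ.
Qed.

Local Notation Cspec P := (Ctilde iota x tauV delta q j P).

(** Maximality is due to [laurent_iota]: inverting [C] on an element of a [delta]-stable [H]-prime
    uses only coefficients from that prime. *)
Lemma contraction_Ctilde P : specH actR P -> let P' := iota @^-1` Cspec P in
  [/\ (P2 delta actR `|` P3 delta actR) P', P' `<=` P &
    forall P'', (P2 delta actR `|` P3 delta actR) P'' -> P'' `<=` P -> P'' `<=` P'].
Proof.
move=> sP P'; have sC := Ctilde_spec sP; have iP := specH_ideal sP.
have hP := specH_Hstable sP; have sP' : specH actR P' := contraction_spec sC.
split.
- have [dP'|dP'] := EM (range delta `<=` P'); [by right|left].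
  split=> [|[]//]; split=> // _ [r P'r <-]; exact: (contraction_delta sC).
- by move=> r; rewrite /P' /preimage /= CtildeE //; apply: laurent_iotaP.
move=> P'' P''23 P''P.
have [sP'' dP''] : specH actR P'' /\ forall r, P'' r -> P'' (delta r).
  case: P''23 => [[[sP'' dP''] _]|[sP'' dP'']]; split=> // r P''r; apply: dP''.
    by exists r.
  by exists r.
have subP'' := ideal_subspace (specH_ideal sP'').1.
move=> r P''r; rewrite /P' /preimage /= CtildeE //.
have [M [p [P''p Ep]]] := laurent_iota subP'' dP'' (Hstable_tauV (specH_Hstable sP'')) P''r.
by exists M, p; split=> // i; apply: P''P.
Qed.

(** This is [P + S x], as [f] differs from its constant coefficient by an element of [S x]. *)
Definition spec_x (P : set R) : set S := [set f | P (co f)`_0].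

Lemma spec_x_spec P : P3 delta actR P -> specH act (spec_x P).
Proof.
move=> [sP dP]; have iP := specH_ideal sP; have hP := specH_Hstable sP.
have subP := ideal_subspace iP.1; have [_ cP] := specH_cprime sP.
have mul0 f g : spec_x P (f * g) <-> P ((co f)`_0 * (co g)`_0).
  rewrite /spec_x /= -[X in P X <-> _](subrK ((co f)`_0 * (co g)`_0)).
  exact: (subspace_addl subP _ (co_mul0 hO f g iP dP)).
have E0 : spec_x P 0 by rewrite /spec_x /= (co0 hO) coef0; apply: subspace0.
have ED f g : spec_x P f -> spec_x P g -> spec_x P (f + g).
  by rewrite /spec_x /= (coD hO) coefD; apply: subspaceD.
split; last first.
  move=> h f; rewrite /spec_x /=; have [c hx] := cau_eigen hS h.
  by rewrite (co_act hS _ _ hx) expr0 scale1r; apply: hP.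
apply: completely_prime_prime; split; last by move=> f g /mul0/cP.
split; last first.
  move=> ET; have : spec_x P 1 by rewrite ET.
  rewrite /spec_x /= -(rmorph1 iota) (co_iota hO) coefC /=.
  exact: specH_not1.
split; split=> // g f Pf; apply/mul0; first exact: tsidealMl.
exact: tsidealMr.
Qed.

Lemma spec_x_onto Q : specH act Q -> Q x -> exists2 P, P3 delta actR P & Q = spec_x P.
Proof.
move=> sQ Qx; have iQ : two_sided_ideal Q by case: sQ => -[[]].
have subQ := ideal_subspace iQ.1.
exists (iota @^-1` Q); first split; first exact: contraction_spec.
  move=> _ [r _ <-].
  have -> : (iota @^-1` Q) (delta r) = Q (x * iota r - iota (tau r) * x).
    by rewrite (ore_comm hO) addrAC subrr add0r.
  by apply: subspaceB => //; [apply: tsidealMr|apply: tsidealMl].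
apply/seteqP; split=> f; rewrite /spec_x /preimage /=.
  rewrite {1}(co_sumE hO (leqnSn (size (co f)))) big_ord_recl expr0 mulr1.
  rewrite subspace_addr //; apply: subspace_sum => // i _.
  by rewrite lift0 exprSr mulrA; apply: tsidealMl.
move=> Qf; rewrite (co_sumE hO (leqnSn (size (co f)))) big_ord_recl expr0 mulr1.
apply: subspaceD => //; apply: subspace_sum => // i _.
by rewrite lift0 exprSr mulrA; apply: tsidealMl.
Qed.

Lemma spec_x_subset P P' : spec_x P `<=` spec_x P' <-> P `<=` P'.
Proof.
split=> PP' => [r Pr|f]; last exact: PP'.
have := PP' (iota r); rewrite /spec_x /= (co_iota hO) coefC; exact.
Qed.

Lemma spec_x_x P : specH actR P -> spec_x P x.
Proof.
by move=> sP; rewrite /spec_x /= (co_x hO) coefX; apply: (tsideal0 (specH_ideal sP)).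
Qed.

Lemma Ctilde_spec_x P P' : specH actR P -> P3 delta actR P' ->
  (Cspec P `<=` spec_x P' <-> iota @^-1` Cspec P `<=` P').
Proof.
move=> sP [sP' dP']; have [[[iC _] _] hC] := Ctilde_spec sP; split=> CP.
  move=> r /CP; rewrite /spec_x /= (co_iota hO) coefC; exact.
by apply: (const_coef_in hS htau h0R h0x lam_nru iC (hC h0) (specH_cprime sP') dP').
Qed.

End Deleting.

(** * Gluing the two strata *)

Theorem theorem3p28 (k : fieldType) (R S : algType k)
  (iota : {lrmorphism R -> S}) (x : S)
  (tau : {lrmorphism R -> R}) (tauV : R -> R) (delta : {linear R -> R}) (q : k)
  (H : groupType) (act : H -> {lrmorphism S -> S}) (actR : H -> {lrmorphism R -> R})
  (hS : cauchon_extension iota x tau tauV delta q act actR)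
  (hH : torus k H)
  (htau : acts_diagonalizably tau)
  (L : unitAlgType k) (j : {lrmorphism S -> L})
  (hL : localization_at_powers x j)
  (n : nat) (m : 'I_n -> 'I_n -> nat) (W : groupType) (s : 'I_n -> W)
  (hW : coxeter_group m s)
  (i0 : 'I_n) (wb : W)
  (hwb : bruhat_lt s wb (wb * s i0)%g)
  (nabla : W -> set R)
  (hnabla : poset_iso (bruhat s) (@subset R) (bruhat_below s wb) (specH actR) nabla)
  (h1 : nabla @` W1 s wb (s i0) = P1 delta actR)
  (h2 : nabla @` W2 s wb (s i0) = P2 delta actR)
  (h3 : nabla @` W3 s wb (s i0) = P3 delta actR) :
  exists nablaT : W -> set S,
    poset_iso (bruhat s) (@subset S) (bruhat_below s (wb * s i0)%g)
      (specH act) nablaT /\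
    forall w, bruhat_below s wb w ->
      nablaT w = Ctilde iota x tauV delta q j (nabla w).
Proof.
have [h0 [h0R [lam h0x lam_nru]]] := cau_h0 hS.
have [leb _] := hwb; have [[nfun _ nsurj] nle] := hnabla.
pose Cs P := Ctilde iota x tauV delta q j P; pose Ds P := spec_x iota x P.
pose a := s i0; pose below w := bruhat s w wb.
pose nablaT w := if `[< below w >] then Cs (nabla w) else Ds (nabla (w * a)%g).
have TC w : below w -> nablaT w = Cs (nabla w) by move=> bw; rewrite /nablaT asboolT.
have TD w : ~ below w -> nablaT w = Ds (nabla (w * a)%g).
  by move=> bw; rewrite /nablaT asboolF.
have nspec w : below w -> specH actR (nabla w) by move=> bw; apply: nfun.
have W3b u : W3 s wb a u -> below u by move/(W3P hW leb); case.
have W3P3 u : W3 s wb a u -> P3 delta actR (nabla u) by move=> u3; rewrite -h3; exists u.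
have W23b u : W2 s wb a u \/ W3 s wb a u -> below u by apply: (W23_below hW leb).
have W23P u : W2 s wb a u \/ W3 s wb a u -> (P2 delta actR `|` P3 delta actR) (nabla u).
  by case=> u23; [left; rewrite -h2|right; rewrite -h3]; exists u.
have CD v u : below v -> W3 s wb a u ->
    (bruhat s v (u * a)%g <-> Cs (nabla v) `<=` Ds (nabla u)).
  move=> bv u3; have [z [z23 zv zmax zu]] := below_max_W23 hW leb bv; rewrite (zu u u3).
  have sv := nspec v bv; have bz := W23b z z23.
  rewrite (Ctilde_spec_x hS htau h0R h0x lam_nru hL sv (W3P3 u u3)).
  have [P23 Pv Pmax] := contraction_Ctilde hS htau h0R h0x lam_nru hL sv.
  rewrite (nle z u bz (W3b u u3)).
  suff -> : nabla z = iota @^-1` Cs (nabla v) by [].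
  apply/seteqP; split.
    by apply: Pmax; [apply: W23P|apply/nle].
  (* The contraction lies in [P2] or [P3], so it is the image of some [z'] below [v], and the
     maximality of [z] bounds it. *)
  have [z' z'23 Ez'] : exists2 z', W2 s wb a z' \/ W3 s wb a z' &
      nabla z' = iota @^-1` Cs (nabla v).
    by case: P23; rewrite -?h2 -?h3 => -[z' z'23 Ez']; exists z'; [left| |right|].
  rewrite -Ez'; have bz' := W23b z' z'23.
  by apply/nle => //; apply: zmax => //; apply/nle => //; rewrite Ez'.
have order v w : bruhat s v (wb * a)%g -> bruhat s w (wb * a)%g ->
    (bruhat s v w <-> nablaT v `<=` nablaT w).
  move=> vb wb'; have [bv|nbv] := EM (below v); have [bw|nbw] := EM (below w).
  - rewrite (TC v bv) (TC w bw) (nle v w bv bw).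
    by apply: iff_sym; apply: (Ctilde_subset hS htau h0R h0x lam_nru hL); apply: nspec.
  - rewrite (TC v bv) (TD w nbw) -CD ?(gen_mulK hW) //.
    exact: (below_gen_cases hW leb wb' nbw).
  - rewrite (TD v nbv) (TC w bw); split=> [vw|DC].
      by case: nbv; apply: bruhat_trans bw.
    (* The element [x] lies in the smaller ideal but not in the larger one. *)
    case: (Ctilde_x hS htau h0R h0x lam_nru hL (nspec w bw)).
    by apply: DC; apply: (spec_x_x hS); apply/nspec/W3b/(below_gen_cases hW leb vb nbv).
  - have v3 := below_gen_cases hW leb vb nbv; have w3 := below_gen_cases hW leb wb' nbw.
    rewrite (TD v nbv) (TD w nbw) (spec_x_subset hS).
    rewrite -(nle _ _ (W3b _ v3) (W3b _ w3)) -(W3_gen_mono hW leb v3 w3).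
    by rewrite !(gen_mulK hW).
exists nablaT; split=> //; split; last exact: order.
split.
- move=> w wba; have [bw|nbw] := EM (below w).
    by rewrite (TC w bw); apply: (Ctilde_spec hS htau h0R h0x lam_nru hL); apply: nspec.
  by rewrite (TD w nbw); apply: (spec_x_spec hS); apply/W3P3/(below_gen_cases hW leb wba nbw).
- move=> v w; rewrite !inE => vb wb' E.
  by apply: bruhat_anti; apply/order => //; rewrite E.
move=> Q sQ; have [Qx|nQx] := EM (Q x).
  have [P P_3 ->] := spec_x_onto hS htau h0R h0x lam_nru hL sQ Qx.
  move: P_3; rewrite -h3 => -[u u3 <-]; exists (u * a)%g; first exact: (W3_below_gen hW leb u3).
  by rewrite TD ?(gen_mulK hW) //; case/(W3P hW leb): u3.
have [P sP ->] := Ctilde_onto hS htau h0R h0x lam_nru hL sQ nQx.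
have [v bv <-] := nsurj P sP; exists v; last exact: TC.
exact: bruhat_trans leb.
Qed.
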